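(* Let $[q]\in\mathcal{S}(I,\mathbb{R}^N)$ and $[w]\in\mathcal{S}_{st}(I,\mathbb{R}^N)$. Then there exist $\tilde q\in[q]$ and $\tilde w\in[w]$ such that $d(\tilde q,\tilde w)=d([q],[w])$.
   Context: $I=[0,1]$; $L^2(I,\mathbb{R}^N)$ has its standard inner product, and $d(q,w)=\|q-w\|_{L^2}$. $\Gamma$ is the group (under composition) of absolutely continuous $\gamma:I\to I$ with $\gamma(0)=0$, $\gamma(1)=1$ and $\gamma'>0$ a.e. It acts on the right on $L^2(I,\mathbb{R}^N)$ by $(q*\gamma)(t)=q(\gamma(t))\sqrt{\gamma'(t)}$. For $q\in L^2(I,\mathbb{R}^N)$, $[q]$ denotes the $L^2$-closure of the orbit $q\Gamma=\{q*\gamma:\gamma\in\Gamma\}$; the sets $[q]$ partition $L^2(I,\mathbb{R}^N)$, and $\mathcal{S}(I,\mathbb{R}^N)$ is the set of all of them. Put $d([q],[w])=\inf\{d(\tilde q,\tilde w):\tilde q\in[q],\tilde w\in[w]\}$. A step function is a function $I\to\mathbb{R}^N$ for which $I$ is a finite disjoint union of subintervals on each of which it is constant (values at endpoints are irrelevant). $\mathcal{S}_{st}(I,\mathbb{R}^N)\subset\mathcal{S}(I,\mathbb{R}^N)$ is the set of classes $[q]$ that contain at least one step function. *)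

(* Defs.v *)
From HB Require Import structures.
From mathcomp Require Import all_boot all_order all_algebra.
From mathcomp Require Import all_classical all_reals all_analysis.

Set Implicit Arguments.
Unset Strict Implicit.
Unset Printing Implicit Defensive.

Import Order.TTheory GRing.Theory Num.Theory.
Import numFieldNormedType.Exports.

Local Open Scope classical_set_scope.
Local Open Scope ring_scope.

(* Functions on I = [0,1] are represented by functions on the whole line, of
   which only the restriction to I matters. *)
Definition unitI (R : realType) : set R := [set` `[0 : R, 1 : R]].
Arguments unitI : clear implicits.

(* Elements of L^2(I, R^N) are represented by square-integrable functions;
   l2dist is a pseudometric whose kernel is equality almost everywhere on I. *)
Definition L2 (R : realType) (N : nat) : set (R -> 'rV[R]_N) :=
  [set q : R -> 'rV[R]_N | forall i : 'I_N,
     measurable_fun (unitI R) (fun t : R => q t 0 i) /\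
     (@lebesgue_measure R).-integrable (unitI R)
       (fun t : R => (q t 0 i ^+ 2)%:E)].
Arguments L2 : clear implicits.

Definition l2dot (R : realType) (N : nat) (q w : R -> 'rV[R]_N) : R :=
  \int[@lebesgue_measure R]_(t in unitI R) (\sum_(i < N) q t 0 i * w t 0 i).

Definition l2norm (R : realType) (N : nat) (q : R -> 'rV[R]_N) : R :=
  Num.sqrt (l2dot q q).

Definition l2dist (R : realType) (N : nat) (q w : R -> 'rV[R]_N) : R :=
  l2norm (fun t => q t - w t).

Definition l2closure (R : realType) (N : nat) (A : set (R -> 'rV[R]_N)) :
    set (R -> 'rV[R]_N) :=
  [set w | L2 R N w /\
     forall e : R, 0 < e -> exists2 v, A v & l2dist w v < e].

Definition abs_continuous (R : realType) (a b : R) (f : R -> R) : Prop :=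
  forall e : R, 0 < e -> exists2 d : R, 0 < d &
    forall (n : nat) (x y : 'I_n -> R),
      (forall i, a <= x i /\ x i <= y i /\ y i <= b) ->
      trivIset setT (fun i => [set` `]x i, y i[]) ->
      \sum_(i < n) (y i - x i) < d ->
      \sum_(i < n) `|f (y i) - f (x i)| < e.

Definition Gamma (R : realType) : set (R -> R) :=
  [set g | [/\ set_fun (unitI R) (unitI R) g,
               abs_continuous 0 1 g,
               g 0 = 0, g 1 = 1 &
               {ae @lebesgue_measure R, forall t, unitI R t ->
                  derivable g t 1 /\ 0 < derive1 g t}]].
Arguments Gamma : clear implicits.

Definition act (R : realType) (N : nat) (q : R -> 'rV[R]_N) (g : R -> R) :
    R -> 'rV[R]_N :=
  fun t => Num.sqrt (derive1 g t) *: q (g t).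

Definition orbit (R : realType) (N : nat) (q : R -> 'rV[R]_N) :
    set (R -> 'rV[R]_N) :=
  [set act q g | g in Gamma R].

Definition shape (R : realType) (N : nat) (q : R -> 'rV[R]_N) :
    set (R -> 'rV[R]_N) :=
  l2closure (orbit q).

Definition shape_space (R : realType) (N : nat) :
    set (set (R -> 'rV[R]_N)) :=
  [set shape q | q in L2 R N].
Arguments shape_space : clear implicits.

Definition shape_dist (R : realType) (N : nat)
    (Q W : set (R -> 'rV[R]_N)) : R :=
  inf [set l2dist qw.1 qw.2 | qw in Q `*` W].

(* One-point intervals are allowed, so values at breakpoints are arbitrary. *)
Definition step_function (R : realType) (N : nat) (q : R -> 'rV[R]_N) : Prop :=
  exists (n : nat) (J : 'I_n -> interval R),
    [/\ unitI R = \bigcup_i [set` J i],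
        trivIset setT (fun i => [set` J i]) &
        forall i, exists c : 'rV[R]_N, forall t, t \in J i -> q t = c].

Definition step_shape_space (R : realType) (N : nat) :
    set (set (R -> 'rV[R]_N)) :=
  [set W | shape_space R N W /\ exists2 w, W w & step_function w].
Arguments step_shape_space : clear implicits.

(* Main.v *)
(** A reparametrization gamma is encoded by its speed g = gamma': absolute
continuity makes gamma the primitive of g, and q * gamma becomes
[pull q g] = sqrt g . (q o warp g), which makes sense and is an L^2 isometry
for every probability density g >= 0 on I. Since (1 - c) g + c tends to g,
allowing g to vanish stays inside the closed orbit [q].

If w is equal to c_k on ]x_k, x_{k+1}[ and s_k is the parameter of q matched
with the breakpoint x_k, then Cauchy-Schwarz on each piece bounds <q * gamma,
w * delta> by
  sum_k sqrt (x_{k+1} - x_k) sqrt (int_{s_k}^{s_{k+1}} max(0, <q, c_k>)^2).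
This is a continuous function of the subdivision s, hence has a maximum on the
compact set of subdivisions. The equality case of Cauchy-Schwarz says how w has
to be traversed to reach the bound, namely with speed proportional to
max(0, <q, c_k>)^2; where this vanishes identically, c_k is traversed instead
while q * gamma pauses, so that it contributes nothing. *)

Require Import Defs.
From HB Require Import structures.
From mathcomp Require Import all_boot all_order all_algebra.
From mathcomp Require Import all_classical all_reals all_analysis.
From mathcomp Require Import measurable_realfun ring lra.
Set Implicit Arguments.
Unset Strict Implicit.
Unset Printing Implicit Defensive.
Import Order.TTheory GRing.Theory Num.Theory.
Import numFieldNormedType.Exports.
Local Open Scope classical_set_scope.
Local Open Scope ring_scope.

(** * Absolutely continuous functions *)

Section real_induction.
Context {R : realType}.

(** Norms are constant along orbits, so minimizing a distance between two orbits amounts to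
    maximizing an inner product; elements of the closures are then reached by approximation. The
    optimum may require a speed that vanishes on a whole interval, which is why it is sought in the
    closed orbits. Since every member of a class generates it, the step function itself can serve as
    base point of [w]. The obstacle to encoding by speeds is that an element of [Gamma] comes with a
    derivative known only almost everywhere. That it is the primitive of this derivative is the
    fundamental theorem of calculus for absolutely continuous functions. It is derived here from a
    single monotonicity statement, applied to differences between the given function and primitives.
    In the other direction, substitution along a primitive that is only nondecreasing is proved by
    comparing measures, so that pauses are covered from the start. *)

Lemma real_induction (a b : R) (P : R -> Prop) : a <= b -> P a ->
  (forall c, a <= c <= b -> exists2 r, 0 < r &
    forall x y, a <= x -> c - r < x <= c -> c <= y < c + r -> y <= b ->
      P x -> P y) ->
  P b.
Proof.
move=> ab Pa step.
pose S := [set x | a <= x <= b /\ P x].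
have Sa : S a by split => //; rewrite lexx.
have ubS : ubound S b by move=> x [/andP[]].
have hS : has_sup S by split; [exists a|exists b].
have acb : a <= sup S <= b.
  apply/andP; split; first exact: sup_upper_bound.
  by apply: ge_sup; [exists a|exact: ubS].
(* A step straddling [sup S] plays the roles of both the limit case and the successor case. *)
have [r r0 stepc] := step _ acb; have /andP[ac cb'] := acb.
have [x [/andP[ax xb] Px] rx] := @sup_adherent _ S r r0 hS.
have xc : x <= sup S by apply: sup_upper_bound => //; split => //; rewrite ax.
have [bc|cb] := leP b (sup S).
  by apply: (stepc x b) => //; apply/andP; split=> //; lra.
pose y := Num.min b (sup S + r / 2).
have yb : y <= b by rewrite /y ge_min lexx.
have cy : sup S < y by rewrite /y lt_min cb/=; lra.
have yc : y < sup S + r by rewrite /y gt_min; apply/orP; right; lra.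
have Py : P y.
  by apply: (stepc x y) => //; apply/andP; split=> //; exact: ltW.
have : y <= sup S.
  by apply: sup_upper_bound => //; split => //; rewrite yb andbT; lra.
by rewrite leNgt cy.
Qed.

End real_induction.

Section AC.
Context {R : realType}.
Notation mu := (@lebesgue_measure R).

(* Disjoint intervals p.1 <= p.2 inside ]a, x], listed from right to left, whose
   total length is controlled by the part of U to the left of x: their length is
   small as soon as the measure of U is. *)
Definition gaps_in (U : set R) (a x : R) (s : seq (R * R)) :=
  [/\ forall p, p \in s -> [/\ a <= p.1, p.1 <= p.2 & p.2 <= x],
      pairwise (fun p q : R * R => q.2 <= p.1) s &
      ((\sum_(p <- s) (p.2 - p.1))%:E <= mu (U `&` `]a, x]))%E].

(** Lists can grow by one interval at a time during the induction, which families indexed by an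
    ordinal do not do easily. *)
Lemma abs_continuous_seq (a b : R) f e : abs_continuous a b f -> 0 < e ->
  exists2 d, 0 < d & forall s : seq (R * R),
    (forall p, p \in s -> [/\ a <= p.1, p.1 <= p.2 & p.2 <= b]) ->
    pairwise (fun p q : R * R => q.2 <= p.1) s ->
    \sum_(p <- s) (p.2 - p.1) < d ->
    \sum_(p <- s) `|f p.2 - f p.1| < e.
Proof.
move=> acf e0; have [d d0 acd] := acf e e0; exists d => // s sab ps.
have sb i : (i < size s)%N -> [/\ a <= (nth (0, 0) s i).1,
    (nth (0, 0) s i).1 <= (nth (0, 0) s i).2 & (nth (0, 0) s i).2 <= b].
  by move=> si; apply: sab; exact: mem_nth.
rewrite !(big_nth (0, 0)) !big_mkord => sd.
apply: (acd (size s) (fun i => (nth (0, 0) s i).1)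
   (fun i => (nth (0, 0) s i).2)) => //.
  by move=> i; have [] := sb i (ltn_ord i).
have key (i j : 'I_(size s)) x : (i < j)%N ->
   x \in `](nth (0, 0) s i).1, (nth (0, 0) s i).2[ ->
   x \in `](nth (0, 0) s j).1, (nth (0, 0) s j).2[ -> False.
  rewrite !in_itv/= => ij /andP[x1 x2] /andP[x3 x4].
  have /pairwiseP := ps => /(_ (0,0) i j); rewrite !inE !ltn_ord => /(_ isT isT ij).
  by rewrite leNgt (lt_trans x1 x4).
move=> i j _ _ [x/= [xi xj]]; apply/val_inj.
by have [ij|ij|//] := ltngtP i j; [case: (key i j x)|case: (key j i x)].
Qed.

Lemma gaps_in_cons (U : set R) a x y s : measurable U -> a <= x -> x <= y ->
  `]x, y] `<=` U -> gaps_in U a x s -> gaps_in U a y ((x, y) :: s).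
Proof.
move=> mU ax xy xyU [sax ps mus]; split.
- move=> p; rewrite inE => /orP[/eqP->//|/sax[? ? px]]; split => //.
  exact: le_trans xy.
- rewrite /= ps andbT; apply/allP => p /sax[? ? ?] //=.
- have -> : U `&` `]a, y] = (U `&` `]a, x]) `|` `]x, y].
    apply/seteqP; split => z/=; rewrite !in_itv/=.
      move=> [Uz /andP[az zy]]; have [zx|xz] := leP z x; [left|right].
        by rewrite az.
      by [].
    move=> [[Uz /andP[-> zx]]|/andP[xz zy]]; split => //.
    - by rewrite (le_trans zx).
    - by apply: xyU; rewrite /= in_itv/= xz.
    - by rewrite (le_lt_trans ax).
  rewrite measureU//; last 2 first.
    exact: measurableI.
    rewrite -subset0 => z/=; rewrite !in_itv/= => -[[_ /andP[_ ?]] /andP[+ _]].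
    by rewrite ltNge => /negP.
  rewrite big_cons/= EFinD addeC; apply: leeD => //.
  rewrite lebesgue_measure_itv/= lte_fin.
  by case: ltP => //; rewrite lee_fin; lra.
Qed.

Lemma gaps_in_widen (U : set R) a x y s : measurable U -> x <= y ->
  gaps_in U a x s -> gaps_in U a y s.
Proof.
move=> mU xy [sax ps mus]; split => //.
- by move=> p /sax[? ? px]; split => //; exact: le_trans xy.
- apply: le_trans mus _; apply: le_measure.
  + by rewrite inE; exact: measurableI.
  + by rewrite inE; exact: measurableI.
  + by apply: setIS => z/=; rewrite !in_itv/= => /andP[-> /le_trans->].
Qed.

Lemma derive1_cvg (f : R -> R) c : derivable f c 1 ->
  (fun h => h^-1 * (f (h + c) - f c)) @ 0^' --> derive1 f c.
Proof.
move=> df; have := df; rewrite /derivable => /cvg_ex[l fl].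
have -> : (fun h => h^-1 * (f (h + c) - f c)) =
    (fun h => h^-1 *: ((f \o shift c) (h *: 1) - f c)).
  by apply/funext => h /=; rewrite [h *: 1]mulr1.
by rewrite derive1E.
Qed.

(** A straddle lemma: the increment splits at c, and each half is controlled by the difference
    quotient at c. *)
Lemma derivable_ge0_near (f : R -> R) c e : derivable f c 1 -> 0 <= derive1 f c ->
  0 < e -> exists2 r, 0 < r & forall x y, c - r < x <= c -> c <= y < c + r ->
    - e * (y - x) <= f y - f x.
Proof.
move=> df f'0 e0.
have := derive1_cvg df.
move/cvgrPdist_lt => /(_ _ e0)/nbhs_ballP[r/= r0 fr].
exists r => //.
have key x : `|x - c| < r -> x != c -> - e < (f x - f c) / (x - c).
  move=> xr xc.
  have := fr (x - c); rewrite /ball/= sub0r normrN subr_eq0 xc => /(_ xr isT).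
  rewrite subrK mulrC ltr_norml => /andP[_]; lra.
move=> x y /andP[rx xc] /andP[cy yr].
have h1 : - e * (c - x) <= f c - f x.
  have [->|xnc] := eqVneq x c; first by rewrite !subrr mulr0.
  have := key x; rewrite ltr_norml xnc => /(_ _ isT).
  have xc' : x < c by rewrite lt_neqAle xnc.
  have -> : (f x - f c) / (x - c) = (f c - f x) / (c - x).
    by rewrite -[RHS]mulrNN -invrN !opprB.
  rewrite ltr_pdivlMr ?subr_gt0// => /(_ _)/ltW; apply; apply/andP; split; lra.
have h2 : - e * (y - c) <= f y - f c.
  have [->|ync] := eqVneq y c; first by rewrite !subrr mulr0.
  have := key y; rewrite ltr_norml ync => /(_ _ isT).
  have yc' : c < y by rewrite lt_neqAle eq_sym ync.
  rewrite ltr_pdivlMr ?subr_gt0// => /(_ _)/ltW; apply; apply/andP; split; lra.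
lra.
Qed.

(** Real induction replaces a covering argument. Absolute continuity is what makes the null set of
    bad points harmless: minus the Cantor function has derivative 0 almost everywhere and yet
    decreases. *)
Lemma abs_continuous_nondecreasing (a b : R) f : a <= b ->
  abs_continuous a b f ->
  {ae mu, forall t, a < t < b -> derivable f t 1 /\ 0 <= derive1 f t} ->
  f a <= f b.
Proof.
move=> ab acf [A [mA A0 badA]].
apply/ler_addgt0Pl => e' e'0.
(* The good points will cost [e * (b - a)] and the gaps [e], together exactly [e']. *)
pose e := e' / (b - a + 1).
have e0 : 0 < e by rewrite divr_gt0// ltr_wpDl// subr_ge0.
have [d d0 acd] := abs_continuous_seq acf e0.
(* The endpoints join the null set because the derivative is only controlled in the open
   interval. *)
pose N := A `|` [set a] `|` [set b].
have mN : measurable N by apply: measurableU => //; exact: measurableU.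
have N0 : mu N = 0%E.
  apply: null_set_setU => //; first exact: measurableU.
    by apply: null_set_setU => //; exact: lebesgue_measure_set1.
  exact: lebesgue_measure_set1.
have [|U [oU NU UN]] := @lebesgue_regularity_outer R N d mN _ d0.
  by rewrite [X in (X < _)%E]N0.
have mU : measurable U by exact: open_measurable.
have muU : (mu U < d%:E)%E.
  rewrite -(setDKU NU) measureU//; last 2 first.
    exact: measurableD.
    by rewrite setIC setDIK.
  by rewrite [X in (_ + X)%E]N0 adde0.
(* U is a small neighborhood of the exceptional null set N; along the induction,
   the loss of f is charged to e * (x - a) outside N and to gaps inside U on N. *)
pose P x := exists2 s, gaps_in U a x s &
  f a - e * (x - a) - \sum_(p <- s) `|f p.2 - f p.1| <= f x.
suff [s [sab ps sU] fb] : P b.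
  have := acd s sab ps.
  have sd : \sum_(p <- s) (p.2 - p.1) < d.
    rewrite -lte_fin (le_lt_trans sU)// (le_lt_trans _ muU)//.
    by apply: le_measure; rewrite ?inE//; exact: measurableI.
  move=> /(_ sd) fe.
  have : e * (b - a + 1) = e'.
    by rewrite /e divfK// gt_eqF// ltr_wpDl// subr_ge0.
  by move: fb; lra.
apply: (@real_induction R a b P) => //.
  exists [::]; last by rewrite big_nil subrr mulr0 !subr0.
  by split => //; rewrite big_nil measure_ge0.
move=> c /andP[ac cb].
have [cN|cN] := pselect (N c).
  have /nbhs_ballP[r/= r0 rU] : nbhs c U.
    by move: oU; rewrite openE => /(_ _ (NU _ cN)).
  exists r => // x y ax /andP[rx xc] /andP[cy yr] yb [s sU fx].
  exists ((x, y) :: s); first apply: gaps_in_cons => //; first lra.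
    move=> z/=; rewrite in_itv/= => /andP[xz zy]; apply: rU.
    by rewrite /ball/= ltr_norml; apply/andP; split; lra.
  rewrite big_cons/=.
  have := ler_norm (f x - f y); rewrite distrC.
  have : e * (x - a) <= e * (y - a) by rewrite ler_pM2l//; lra.
  lra.
have [df f'0] : derivable f c 1 /\ 0 <= derive1 f c.
  apply: contrapT => badc; apply: (cN); left; left; apply: badA => /= H.
  apply: badc; apply: H; apply/andP; split.
    by rewrite lt_neqAle ac andbT; apply/eqP => ca; apply: (cN); left; right.
  by rewrite lt_neqAle cb andbT; apply/eqP => ca; apply: (cN); right.
have [r r0 fr] := derivable_ge0_near df f'0 e0.
exists r => // x y ax rx yr yb [s sU fx]; exists s.
  apply: gaps_in_widen sU => //.
  by case/andP : rx => _ /le_trans; apply; case/andP : yr.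
have := fr x y rx yr; lra.
Qed.

End AC.

(** * Change of variables *)

Section integral_transfer.
Import HBNNSimple.
Local Open Scope ereal_scope.
Context {R : realType}.
Notation mu := (@lebesgue_measure R).


Variables (u F : R -> R) (D E : set R).
Hypotheses (mD : measurable D) (mE : measurable E).
Hypotheses (mu_u : measurable_fun setT u) (u0 : forall t, (0 <= u t)%R).
Hypothesis mF : measurable_fun setT F.
Hypothesis transfer : forall A, measurable A ->
  \int[mu]_(t in D) (\1_A (F t) * u t)%:E = mu (A `&` E).

(** The usual extension from indicators: linearity for simple functions, then monotone
    convergence. *)
Lemma integral_transfer (f : R -> \bar R) : measurable_fun setT f ->
  (forall y, 0 <= f y) ->
  \int[mu]_(t in D) (f (F t) * (u t)%:E) = \int[mu]_(y in E) f y.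
Proof.
move=> mf f0.
pose h := nnsfun_approx measurableT mf.
have hcvg y : (h n y)%:E @[n --> \oo] --> f y by exact: cvg_nnsfun_approx.
have hnd y : {homo (fun n => (h n y)%:E) : m n / (m <= n)%N >-> m <= n}.
  by move=> m n mn; rewrite lee_fin; exact/lefP/nd_nnsfun_approx.
have mh n : measurable_fun setT (h n) by exact/measurable_funP.
have mhF n : measurable_fun D (fun t => (h n (F t) * u t)%:E).
  apply/measurable_EFinP/measurable_funTS/measurable_funM => //.
  exact: measurableT_comp.
have cvgr : \int[mu]_(y in E) (h n y)%:E @[n --> \oo] --> \int[mu]_(y in E) f y.
  under eq_integral => y _ do rewrite -(cvg_lim _ (hcvg y))//.
  apply: cvg_monotone_convergence => //.
  - by move=> n; apply/measurable_EFinP/measurable_funTS; exact: mh.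
  - by move=> n y _; rewrite lee_fin.
have cvgl : \int[mu]_(t in D) (h n (F t) * u t)%:E @[n --> \oo] -->
    \int[mu]_(t in D) (f (F t) * (u t)%:E).
  have fE t : f (F t) * (u t)%:E = limn (fun n => (h n (F t) * u t)%:E).
    apply/esym/cvg_lim => //.
    under eq_fun do rewrite EFinM.
    by apply: cvgeZr.
  under eq_integral => t _ do rewrite fE.
  apply: cvg_monotone_convergence => //.
  - by move=> n t _; rewrite lee_fin mulr_ge0.
  - by move=> t _ m n mn; rewrite lee_fin ler_wpM2r// -lee_fin; exact: hnd.
apply: (cvg_unique _ cvgl); first exact: ereal_hausdorff.
suff -> : (fun n => \int[mu]_(t in D) (h n (F t) * u t)%:E) =
          (fun n => \int[mu]_(y in E) (h n y)%:E) by [].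
apply/funext => n.
have mhr r : measurable (h n @^-1` [set r]) by [].
have m1F r : measurable_fun setT (fun t => \1_(h n @^-1` [set r]) (F t) : R).
  have m1 : measurable_fun setT (\1_(h n @^-1` [set r]) : R -> R).
    exact: measurable_indic.
  exact: (measurableT_comp m1 mF).
have hE t : (h n t)%:E =
    \sum_(y \in range (h n)) (y * \1_(h n @^-1` [set y]) t)%:E.
  by rewrite /= fimfunE -fsumEFin.
transitivity (\int[mu]_(t in D) (\sum_(y \in range (h n))
    (y * \1_(h n @^-1` [set y]) (F t) * u t)%:E)).
  apply: eq_integral => t _; rewrite EFinM hE ge0_mule_fsuml//.
  by move=> y; exact: nnfun_muleindic_ge0.
have nn r t : 0 <= (r * \1_(h n @^-1` [set r]) t)%:E.
  by exact: nnfun_muleindic_ge0.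
rewrite ge0_integral_fsum//; last 2 first.
  - move=> y; apply/measurable_EFinP/measurable_funTS/measurable_funM => //.
    apply: measurable_funM => //.
    exact: m1F.
  - by move=> y t _; rewrite EFinM mule_ge0 ?lee_fin//; exact: nn.
under [RHS]eq_integral do rewrite hE.
rewrite ge0_integral_fsum//; last first.
  by move=> y; apply/measurable_EFinP/measurable_funM => //; apply: measurable_indic; exact: mhr.
apply: eq_fsbigr => r; rewrite inE => -[t0 _ rE].
have r0 : (0 <= r)%R by rewrite -rE.
under eq_integral do rewrite -mulrA EFinM.
rewrite ge0_integralZl_EFin//; last 2 first.
  - by move=> t _; rewrite lee_fin mulr_ge0.
  - apply/measurable_EFinP/measurable_funTS/measurable_funM => //.
    exact: m1F.
rewrite transfer//.
under eq_integral do rewrite EFinM.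
rewrite ge0_integralZl_EFin//; last first.
  by apply/measurable_EFinP/measurable_indic; exact: mhr.
by rewrite integral_indic//; exact: mhr.
Qed.

End integral_transfer.

Section change_of_variables.
Context {R : realType}.
Notation mu := (@lebesgue_measure R).

Variables (a b : R) (u F : R -> R).
Hypothesis ab : a <= b.
Hypotheses (mu_u : measurable_fun setT u) (u0 : forall t, 0 <= u t).
Hypothesis cF : continuous F.
Hypothesis uF : forall x y, a <= x -> x <= y -> y <= b ->
  (\int[mu]_(t in `[x, y]) (u t)%:E = (F y - F x)%:E)%E.

Let mF : measurable_fun setT F. Proof. exact: continuous_measurable_fun. Qed.

Let F_nd x y : a <= x -> x <= y -> y <= b -> F x <= F y.
Proof.
move=> ax xy yb; rewrite -subr_ge0 -lee_fin -uF//.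
by apply: integral_ge0 => t _; rewrite lee_fin.
Qed.

Definition weight_pushforward (A : set (measurableTypeR R)) : \bar R :=
  \int[mu]_(t in F @^-1` A `&` `[a, b]) (u t)%:E.

Let mFA A : measurable A -> measurable (F @^-1` A `&` `[a, b]).
Proof. by move=> mA; apply: measurableI => //; rewrite -[X in measurable X]setTI; exact: mF. Qed.

Notation nu := weight_pushforward.

Let nu0 : nu set0 = 0%E.
Proof. by rewrite /weight_pushforward preimage_set0 set0I integral_set0. Qed.

Let nu_ge0 A : (0 <= nu A)%E.
Proof. by apply: integral_ge0 => t _; rewrite lee_fin. Qed.

Let nu_sigma_additive : semi_sigma_additive nu.
Proof.
move=> /= G mG tG mUG; rewrite /weight_pushforward; apply: cvg_toP.
  apply: ereal_nondecreasing_is_cvgn => m n mn.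
  apply: lee_sum_nneg_natr => // k _ _; apply: integral_ge0 => /= x _.
  by rewrite lee_fin.
rewrite preimage_bigcup setI_bigcupl ge0_integral_bigcup//=.
- by move=> k; apply: mFA; exact: mG.
- exact/measurable_EFinP/measurable_funTS.
- by move=> x _; rewrite lee_fin.
- by move=> i j _ _ [t [[Git _] [Gjt _]]]; apply: (tG i j) => //; exists (F t).
Qed.

HB.instance Definition _ := isMeasure.Build _ _ _ nu nu0 nu_ge0 nu_sigma_additive.

(** T is the first time at which F reaches x. F may be constant on intervals, so T is a minimum over
    a compact set rather than a value of an inverse. *)
Let ray_point x : F a < x -> x <= F b -> exists T,
  [/\ a <= T <= b, F T = x & F @^-1` `]-oo, x[ `&` `[a, b] = `[a, T[%classic].
Proof.
move=> ax xb.
pose S := `[a, b] `&` F @^-1` `[x, +oo[.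
have S0 : S !=set0 by exists b; split; rewrite /= in_itv/= ?andbT ?lexx ?ab.
have cS : compact S.
  apply: (@subclosed_compact _ _ `[a, b]); [|exact: segment_compact|exact: subIsetl].
  apply: closedI; first exact: interval_closed.
  by apply: closed_comp; [move=> ? _; exact: cF|exact: interval_closed].
have [|T /[!inE] -[/= Tab]] := @compact_EVT_min _ R id S S0 cS.
  by apply: continuous_subspaceT => ?; exact: cvg_id.
rewrite in_itv/= andbT => xT Tmin.
move: Tab; rewrite in_itv/= => /andP[aT Tb].
have FT : F T = x.
  apply/eqP; rewrite eq_le xT andbT leNgt; apply/negP => xFT.
  have [||t] := @IVT R F a T x aT.
  - exact: continuous_subspaceT.
  - rewrite ge_min le_max (ltW ax) xT orbT//.
  rewrite in_itv/= => /andP[atl tT] Ft.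
  have : T <= t.
    apply: Tmin; rewrite inE; split; rewrite /= in_itv/= ?Ft ?lexx//.
    by rewrite atl (le_trans tT).
  by move=> Tt; move: xFT; rewrite -Ft (_ : t = T) ?ltxx//; apply/eqP; rewrite eq_le tT.
exists T; split => //; first by rewrite aT.
apply/seteqP; split => t /=; rewrite !in_itv/=.
  move=> [Ftx /andP[-> tb]] /=; rewrite ltNge; apply/negP => Tt.
  by move: Ftx; rewrite ltNge -FT F_nd.
move=> /andP[at_ tT]; rewrite at_ (le_trans (ltW tT))//; split=> //.
rewrite ltNge; apply/negP => xFt.
have : T <= t.
  apply: Tmin; rewrite inE; split; rewrite /= in_itv/= ?andbT//.
  by rewrite at_ (le_trans (ltW tT)).
by rewrite leNgt tT.
Qed.

Let uFo x y : a <= x -> x <= y -> y <= b ->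
  (\int[mu]_(t in `[x, y[) (u t)%:E = (F y - F x)%:E)%E.
Proof.
move=> ax xy yb; rewrite -uF// integral_itv_bndo_bndc//.
exact/measurable_EFinP/measurable_funTS.
Qed.

(** Open rays to the left generate the Borel sets and are stable under intersection, so two measures
    that agree and are finite on them coincide. *)
Let nuE A : measurable A -> nu A = mu (A `&` `[F a, F b]).
Proof.
move=> mA; have mI : measurable (`[F a, F b] : set (measurableTypeR R)) by [].
change (nu A = mrestr mu mI A).
pose m1 : {measure set (measurableTypeR R) -> \bar R} := weight_pushforward.
pose m2 : {measure set (measurableTypeR R) -> \bar R} := mrestr mu mI.
apply: (@measure_unique _ R (measurableTypeR R) (@RGenInftyO.G R)
  (fun n => `]-oo, n%:R[%classic) _ _ _ _ m1 m2) => //.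
- exact: RGenInftyO.measurableE.
- move=> _ _ [x ->] [y ->]; exists (Num.min x y).
  by apply/seteqP; split => z /=; rewrite !in_itv/= lt_min;
    [move=> [-> ->]|move=> /andP[]].
- by move=> n; exists n%:R.
- apply/seteqP; split => // x _; exists (Num.truncn `|x|).+1 => //=.
  by rewrite in_itv/= (le_lt_trans (ler_norm _))// truncnS_gt.
- move=> _ [x ->]; rewrite /m1 /m2 /= /mrestr /weight_pushforward.
  have [xa|ax] := leP x (F a).
    rewrite [X in integral _ X _](_ : _ = set0); last first.
      rewrite -subset0 => t /=; rewrite !in_itv/= => -[Ftx /andP[at_ tb]].
      have := F_nd (lexx a) at_ tb; lra.
    rewrite integral_set0 [X in mu X](_ : _ = set0) ?measure0//.
    by rewrite -subset0 => t /=; rewrite !in_itv/= => -[? /andP[? ?]]; lra.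
  have [xb|bx] := leP x (F b); last first.
    rewrite [X in integral _ X _](_ : _ = `[a, b]%classic); last first.
      apply/seteqP; split => t /=; rewrite !in_itv/=; first by case.
      move=> /andP[at_ tb]; rewrite at_ tb; split => //.
      by rewrite (le_lt_trans _ bx)// F_nd.
    rewrite uF// [X in mu X](_ : _ = `[F a, F b]%classic); last first.
      apply/seteqP; split => t /=; rewrite !in_itv/=; first by case.
      by move=> /andP[-> tb]; rewrite tb (le_lt_trans tb bx).
    rewrite lebesgue_measure_itv/= lte_fin.
    by case: ltgtP (F_nd (lexx a) ab (lexx b)) => // -> _; rewrite subrr.
  have [T [/andP[aT Tb] FT ->]] := ray_point ax xb.
  rewrite uFo// FT [X in mu X](_ : _ = `[F a, x[%classic); last first.
    apply/seteqP; split => t /=; rewrite !in_itv/=.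
      by move=> [-> /andP[-> _]].
    by move=> /andP[-> tx]; rewrite tx (le_trans (ltW tx)).
  by rewrite lebesgue_measure_itv/= lte_fin ax.
- move=> n; rewrite (@le_lt_trans _ _ (F b - F a)%:E) ?ltry// -uF//.
  apply: ge0_subset_integral => //.
  + exact: mFA.
  + exact/measurable_EFinP/measurable_funTS.
  + by move=> x _; rewrite lee_fin.
Qed.

(** F is known only through its increments, so the formula comes from the image measure and not from
    derivatives. Extending f by 0 reduces to functions on the line. *)
Lemma ge0_integral_substitution (f : R -> \bar R) : measurable_fun `[F a, F b] f ->
  (forall y, F a <= y <= F b -> (0 <= f y)%E) ->
  (\int[mu]_(t in `[a, b]) (f (F t) * (u t)%:E) =
   \int[mu]_(y in `[F a, F b]) f y)%E.
Proof.
move=> mf f0; rewrite [RHS]integral_mkcond/=.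
pose f' := f \_ `[F a, F b].
transitivity (\int[mu]_(t in `[a, b]) (f' (F t) * (u t)%:E))%E.
  apply: eq_integral => t; rewrite inE/= in_itv/= => /andP[at_ tb].
  by rewrite /f' patchE mem_set//= in_itv/= !F_nd.
transitivity (\int[mu]_(y in `[F a, F b]) f' y)%E; last first.
  rewrite [LHS]integral_mkcond; apply: eq_integral => y _.
  by rewrite /f' !patchE; case: ifPn => // yI; rewrite yI.
apply: integral_transfer => //.
- move=> A mA; rewrite -nuE// /weight_pushforward [RHS]integral_mkcondl/=.
  apply: eq_integral => t _; rewrite patchE/= indicE.
  have -> : (t \in F @^-1` A) = (F t \in A) by apply/idP/idP; rewrite !inE.
  by case: (F t \in A); rewrite ?mul1r ?mul0r.
- by apply/(measurable_restrictT _ _).1.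
- by move=> y; rewrite /f' patchE; case: ifPn => //; rewrite inE/= in_itv/=; exact: f0.
Qed.

End change_of_variables.

(** * Primitives of integrable functions *)

Section primitive.
Context {R : realType}.
Notation mu := (@lebesgue_measure R).

Definition primitive (h : R -> R) (x : R) : R :=
  \int[mu]_(t in `]-oo, x]) h t.

Variable h : R -> R.
Hypothesis ih : mu.-integrable setT (EFin \o h).

Let ihS (A : set R) : measurable A -> mu.-integrable A (EFin \o h).
Proof. by move=> mA; exact: integrableS ih. Qed.

Lemma primitiveB x y : x <= y ->
  primitive h y - primitive h x = \int[mu]_(t in `]x, y]) h t.
Proof.
move=> xy; rewrite /primitive Rintegral_itvB//; exact: ihS.
Qed.

(** The sum of increments is at most the integral of [|h|] over the union of the intervals, which is
    small with the measure of this union. *)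
Lemma primitive_abs_continuous a b : abs_continuous a b (primitive h).
Proof.
move=> e e0; have [d [d0 hd]] := integral_normr_continuous ih e0.
exists d => // n x y xy tI.
pose I (i : 'I_n) : set (measurableTypeR R) := `]x i, y i[%classic.
pose D := \big[setU/set0]_(i <- index_enum 'I_n) I i.
have mI i : measurable (I i) by exact: measurable_itv.
have tI' : trivIset [set` index_enum 'I_n] I.
  by apply: sub_trivIset tI.
have mD : measurable D by apply: bigsetU_measurable.
have muD : mu D = (\sum_(i < n) (y i - x i))%:E.
  have := @integral_cst _ _ _ mu D mD 1; rewrite mul1e => <-.
  rewrite ge0_integral_bigsetU//; last exact: index_enum_uniq.
  rewrite -sumEFin; apply: eq_bigr => i _.
  rewrite integral_cst// mul1e [LHS]lebesgue_measure_itv/= lte_fin.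
  have [_ [xyi _]] := xy i; rewrite -EFinB; case: ltgtP xyi => // -> _.
  by rewrite subrr.
move=> sd; have Dd : (mu D < d%:E)%E by rewrite muD lte_fin.
have inh : mu.-integrable setT (EFin \o (Num.norm \o h)) by exact: integrable_norm.
apply: le_lt_trans (hd D mD Dd).
rewrite /Rintegral ge0_integral_bigsetU//; last 2 first.
  exact: index_enum_uniq.
  by apply/measurable_EFinP/measurable_funTS; apply/measurable_EFinP; case/integrableP : inh.
rewrite [X in fine X](_ : _ = (\sum_(i < n) \int[mu]_(t in I i) `|h t|)%:E).
  apply: ler_sum => i _; have [xi [xyi yi]] := xy i.
  rewrite primitiveB// -Rintegral_itv_bndo_bndc; last exact: ihS.
  by apply: le_normr_Rintegral => //; exact: ihS.
rewrite -sumEFin; apply: eq_bigr => i _; rewrite fineK//.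
by apply: integrable_fin_num => //; exact: (integrableS measurableT).
Qed.

Lemma primitive_ae_derivable :
  {ae mu, forall x, derivable (primitive h) x 1 /\ derive1 (primitive h) x = h x}.
Proof.
apply: FTC1Ny; first by move=> y; exact: ihS.
have := integrable_locally measurableT ih; by rewrite patch_setT.
Qed.

End primitive.

Section abs_continuous_theory.
Context {R : realType}.
Notation mu := (@lebesgue_measure R).
Implicit Types f g : R -> R.

Lemma abs_continuous_dist a b f e : abs_continuous a b f -> 0 < e ->
  exists2 d, 0 < d & forall x y, a <= x -> x <= y -> y <= b -> y - x < d ->
    `|f y - f x| < e.
Proof.
move=> acf e0; have [d d0 fd] := acf _ e0; exists d => // x y ax xy yb xyd.
have := fd 1 (fun=> x) (fun=> y); rewrite !big_ord1; apply => //.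
by move=> i j _ _ _; rewrite !ord1.
Qed.

Lemma abs_continuous_sub a b x f : x <= b ->
  abs_continuous a b f -> abs_continuous a x f.
Proof.
move=> xb acf e e0; have [d d0 fd] := acf e e0; exists d => // n u v uv.
by apply: fd => i; have [? [? /le_trans->]] := uv i.
Qed.

Lemma abs_continuousB a b f g :
  abs_continuous a b f -> abs_continuous a b g ->
  abs_continuous a b (fun x => f x - g x).
Proof.
move=> acf acg e e0.
have [d1 d10 fd] := acf _ (divr_gt0 e0 (ltr0n R 2)).
have [d2 d20 gd] := acg _ (divr_gt0 e0 (ltr0n R 2)).
exists (Num.min d1 d2); first by rewrite lt_min d10.
move=> n x y xy tI; rewrite lt_min => /andP[s1 s2].
have h1 := fd n x y xy tI s1; have h2 := gd n x y xy tI s2.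
rewrite (splitr e); apply: le_lt_trans (ltrD h1 h2).
rewrite -big_split/=; apply: ler_sum => i _.
rewrite (_ : _ - _ = (f (y i) - f (x i)) - (g (y i) - g (x i))); last lra.
exact: ler_normB.
Qed.

(** Serves twice: applied to the argument, it extends a function from [a, b] to the line by
    constants; applied to the value, it truncates. *)
Definition clamp a b t : R := Num.max a (Num.min b t).

Lemma clamp_id a b t : a <= t <= b -> clamp a b t = t.
Proof. by move=> /andP[at_ tb]; rewrite /clamp min_r// max_r. Qed.

Lemma clamp_nd a b : {homo clamp a b : x y / x <= y}.
Proof.
move=> x y xy; rewrite /clamp ge_max le_max lexx/= le_max; apply/orP; right.
by rewrite le_min !ge_min lexx xy orbT.
Qed.

Lemma clamp_in a b t : a <= b -> a <= clamp a b t <= b.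
Proof. by move=> ab; rewrite /clamp le_max lexx ge_max ab ge_min lexx. Qed.

Lemma clampB a b x y : x <= y -> clamp a b y - clamp a b x <= y - x.
Proof.
move=> xy.
have ax : a <= clamp a b x by rewrite /clamp le_max lexx.
have bx : Num.min b x <= clamp a b x by rewrite /clamp le_max lexx orbT.
suff : clamp a b y <= clamp a b x + (y - x) by lra.
rewrite {1}/clamp ge_max; apply/andP; split; first lra.
have [bx'|xb] := leP b x; rewrite ge_min; apply/orP.
  have bcx : b <= clamp a b x by rewrite -{1}(min_l bx').
  by left; lra.
have xcx : x <= clamp a b x by rewrite -{1}(min_r (ltW xb)).
by right; lra.
Qed.

Lemma clamp_lipschitz a b x y : `|clamp a b x - clamp a b y| <= `|x - y|.
Proof.
wlog yx : x y / y <= x => [H|].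
  by have [|/ltW] := leP y x => /H //; rewrite distrC [X in _ <= X]distrC.
by rewrite !ger0_norm ?subr_ge0 ?clampB ?clamp_nd.
Qed.

Lemma clamp_continuous a b f : a <= b -> abs_continuous a b f ->
  continuous (fun t => f (clamp a b t)).
Proof.
move=> ab acf x; apply/cvgrPdist_lt => e e0.
have [d d0 fd] := abs_continuous_dist acf e0.
near=> y.
have xyd : `|x - y| < d.
  by near: y; apply/nbhs_ballP; exists d => //.
have key u v : u <= v -> `|v - u| < d ->
    `|f (clamp a b v) - f (clamp a b u)| < e.
  move=> uv uvd.
  have /andP[au bu] := clamp_in u ab; have /andP[av bv] := clamp_in v ab.
  apply: fd => //; first exact: clamp_nd.
  by apply: le_lt_trans uvd; rewrite (le_trans (clampB _ _ uv))// ler_norm.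
have [xy|/ltW yx] := leP x y; last exact: key.
by rewrite distrC; apply: key => //; rewrite distrC.
Unshelve. all: by end_near. Qed.

Lemma primitive_continuous f :
  mu.-integrable setT (EFin \o f) -> continuous (primitive f).
Proof.
move=> intf x; have := @clamp_continuous (x - 1) (x + 1) (primitive f).
have /[swap]/[apply] := @primitive_abs_continuous _ _ intf (x - 1) (x + 1).
have le1 : x - 1 <= x + 1 by lra.
move=> /(_ le1 x); rewrite /continuous_at /= clamp_id; last by apply/andP; split; lra.
apply: cvg_trans; apply: near_eq_cvg; near=> y.
rewrite clamp_id//; apply/andP; split.
  by apply: ltW; near: y; apply: lt_nbhsr; lra.
by apply: ltW; near: y; apply: lt_nbhsl; lra.
Unshelve. all: by end_near. Qed.

Lemma primitive_unitI0 f : primitive (f \_ (unitI R)) 0 = 0.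
Proof.
rewrite /primitive -Rintegral_mkcondr (_ : _ `&` _ = [set 0]).
  exact: Rintegral_set1.
apply/seteqP; split => t /=; rewrite !in_itv/=.
  by move=> [t0 /andP[t0' _]]; apply/eqP; rewrite eq_le t0.
by move=> ->; rewrite /unitI /= in_itv/= !lexx ler01.
Qed.

Lemma primitive_unitI1 f : primitive (f \_ (unitI R)) 1 =
  \int[mu]_(t in unitI R) f t.
Proof.
rewrite /primitive -Rintegral_mkcondr; congr Rintegral.
by rewrite /unitI; apply/seteqP; split => t /=; rewrite !in_itv/= ; [case|move=> /andP[-> ->]].
Qed.

End abs_continuous_theory.

(** * Speeds of reparametrizations *)

Section densities.
Context {R : realType}.
Notation mu := (@lebesgue_measure R).

(** Measurability and sign are imposed on the whole line, which keeps compositions free of side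
    conditions; only the mass refers to I. *)
Definition density (g : R -> R) :=
  [/\ measurable_fun setT g, forall t, 0 <= g t &
      (\int[mu]_(t in unitI R) (g t)%:E)%E = 1%E].

(* The reparametrization of I with speed g; it is constant outside I. *)
Definition warp (g : R -> R) := primitive (g \_ (unitI R)).

Lemma aeS (P Q : R -> Prop) : (forall t, P t -> Q t) ->
  {ae mu, forall t, P t} -> {ae mu, forall t, Q t}.
Proof.
move=> PQ [A [mA A0 PA]]; exists A; split => //.
by apply: subset_trans PA => t /= + /PQ.
Qed.

Lemma aeS2 (P Q S : R -> Prop) : (forall t, P t -> Q t -> S t) ->
  {ae mu, forall t, P t} -> {ae mu, forall t, Q t} -> {ae mu, forall t, S t}.
Proof.
move=> PQS [A [mA A0 PA]] [B [mB B0 QB]]; exists (A `|` B); split.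
- exact: measurableU.
- exact: null_set_setU.
- move=> t /= nS; apply: contrapT => /not_orP[nA nB]; apply: nS; apply: PQS.
    by apply: contrapT => nP; exact/nA/PA.
  by apply: contrapT => nQ; exact/nB/QB.
Qed.

Lemma measurable_unitI : measurable (unitI R : set (measurableTypeR R)).
Proof. exact: measurable_itv. Qed.

Lemma unitI_lty : (mu (unitI R) < +oo)%E.
Proof. by rewrite /unitI lebesgue_measure_itv/= lte01 -EFinB ltry. Qed.

Lemma integrable_patch_unitI (g : R -> R) :
  mu.-integrable (unitI R) (EFin \o g) <->
  mu.-integrable setT (EFin \o (g \_ (unitI R))).
Proof.
rewrite -restrict_EFin.
exact: (@integrable_mkcond _ _ R mu (unitI R) (EFin \o g) measurable_unitI).
Qed.

Lemma ge0_integrable (D : set R) (g : R -> R) : measurable D ->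
  measurable_fun D g -> (forall t, D t -> 0 <= g t) ->
  (\int[mu]_(t in D) (g t)%:E < +oo)%E -> mu.-integrable D (EFin \o g).
Proof.
move=> mD mg g0 gy; apply/integrableP; split; first exact/measurable_EFinP.
by under eq_integral => t /[!inE] Dt do rewrite /= ger0_norm ?g0//.
Qed.

Lemma density_integrable g : density g -> mu.-integrable (unitI R) (EFin \o g).
Proof.
move=> [mg g0 g1]; apply: ge0_integrable => //; last by rewrite g1 ltry.
exact: measurable_unitI.
exact: measurable_funTS.
Qed.

(** Exhibits the derivative as the limit of a sequence of functions that are measurable as soon as f
    is continuous on [a, b]; [clamp] avoids evaluating f outside. *)
Lemma derive1_difference_quotient (f : R -> R) a b t : a < t < b ->
  derivable f t 1 ->
  n.+1%:R * (f (clamp a b (t + n.+1%:R^-1)) - f (clamp a b t)) @[n --> \oo]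
    --> derive1 f t.
Proof.
move=> /andP[at_ tb] df; have fc := derive1_cvg df.
have := (cvgr_dnbhsP _ _ _).1 fc (fun n => n.+1%:R^-1) (conj _ (@cvg_harmonic R)).
have n0 (n : nat) : n.+1%:R^-1 != 0 :> R by rewrite invr_eq0.
move=> /(_ n0); apply: cvg_trans; apply: near_eq_cvg; near=> n => /=.
rewrite invrK [_^-1 + t]addrC [clamp a b t]clamp_id ?(ltW at_) ?(ltW tb)//.
rewrite clamp_id//. apply/andP; split.
  by rewrite (le_trans (ltW at_))// lerDl.
rewrite -lerBrDl ltW//; near: n.
by apply: (near_infty_natSinv_lt (PosNum _)); rewrite subr_gt0.
Unshelve. all: by end_near. Qed.

Lemma ae_interior (a b : R) : {ae mu, forall t, a <= t <= b -> a < t < b}.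
Proof.
exists [set a; b]; split.
- exact: measurableU.
- apply: null_set_setU => //; exact: lebesgue_measure_set1.
- move=> t /= /not_implyP[/andP[at_ tb]] nt.
  have [->|ta] := eqVneq t a; first by left.
  have [->|tb'] := eqVneq t b; first by right.
  by exfalso; apply: nt; rewrite !lt_neqAle at_ tb eq_sym ta tb'.
Qed.

(** * Elements of [Gamma] as primitives of their derivatives *)

Section from_Gamma.
Variable gam : R -> R.
Hypothesis Ggam : Gamma R gam.

Let acg : abs_continuous 0 1 gam. Proof. by case: Ggam. Qed.

(* derive1 gam is only known to be meaningful almost everywhere; [speed] is a
   measurable function equal to it wherever gam is derivable, and g is moreover
   positive everywhere. *)
Let quot n t := n.+1%:R *
  (gam (clamp 0 1 (t + n.+1%:R^-1)) - gam (clamp 0 1 t)).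

Let speed t := fine (limn_esup (fun n => (quot n t)%:E)).

Let g t := if 0 < speed t then speed t else 1.

Let g_gt0 t : 0 < g t.
Proof. by rewrite /g; case: ifPn. Qed.

Let mg : measurable_fun setT g.
Proof.
have mgc : measurable_fun setT (fun t => gam (clamp 0 1 t)).
  apply: continuous_measurable_fun; apply: clamp_continuous => //; exact: ler01.
have mq n : measurable_fun setT (quot n).
  apply: measurable_funM => //; apply: measurable_funB => //.
  by apply: (measurableT_comp mgc); exact: measurable_funD.
have ms : measurable_fun setT speed.
  apply: measurableT_comp => //; apply: measurable_fun_limn_esup => n.
  exact/measurable_EFinP.
by apply: measurable_fun_ifT => //; exact: measurable_fun_ltr.
Qed.

Let aeg : {ae mu, forall t, 0 < t < 1 ->
  [/\ derivable gam t 1, 0 < derive1 gam t & derive1 gam t = g t]}.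
Proof.
case: Ggam => _ _ _ _; apply: aeS => t H t01.
have /H[dg dg0] : unitI R t.
  by rewrite /unitI/= in_itv/=; case/andP : t01 => /ltW-> /ltW->.
split => //.
have := derive1_difference_quotient t01 dg => cq.
have E : speed t = derive1 gam t.
  rewrite /speed.
  have /cvg_limn_einf_sup[_ ->] // : (fun n => (quot n t)%:E) @ \oo --> (derive1 gam t)%:E.
  by apply: cvg_EFin => //; exact: nearW.
by rewrite /g E dg0.
Qed.

(* Integrability of g is not known yet: gam is first compared with the primitives
   of the bounded functions min(g, M), then M tends to infinity. *)
Let trunc M := (fun t => Num.min (g t) M%:R) \_ (unitI R).

Let integrable_trunc M : mu.-integrable setT (EFin \o trunc M).
Proof.
apply/integrable_patch_unitI; apply: measurable_bounded_integrable.
- exact: measurable_unitI.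
- exact: unitI_lty.
- by apply: measurable_funTS; exact: measurable_minr.
- exists M%:R; split; first exact: num_real.
  move=> x Mx t _ /=; rewrite ger0_norm ?ge_min; last by rewrite le_min ltW/=.
  by apply/orP; right; exact: ltW.
Qed.

(** The difference between [gam] and the primitive of h has a nonnegative derivative almost
    everywhere. Integrability of h is what provides the derivative of its primitive. *)
Let comparison h : mu.-integrable setT (EFin \o h) ->
  (forall t, 0 < t < 1 -> h t <= g t) -> forall x, 0 <= x <= 1 ->
  primitive h x - primitive h 0 <= gam x.
Proof.
move=> ih hg x /andP[x0 x1].
have : gam 0 - primitive h 0 <= gam x - primitive h x.
  apply: (@abs_continuous_nondecreasing _ 0 x (fun t => gam t - primitive h t)) => //.
    apply: abs_continuousB; last exact: primitive_abs_continuous.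
    exact: abs_continuous_sub acg.
  move: aeg (primitive_ae_derivable ih); apply: aeS2 => t H1 [dh dhE] /andP[t0 tx].
  have t01 : 0 < t < 1 by rewrite t0 (lt_le_trans tx).
  have [dg _ dgE] := H1 t01; split; first exact: derivableB.
  rewrite derive1E deriveB// -!derive1E dhE dgE subr_ge0; exact: hg.
by case: Ggam => _ _ -> _ _; lra.
Qed.

Let integral_g_le1 : (\int[mu]_(t in unitI R) (g t)%:E <= 1)%E.
Proof.
have cvgt : (\int[mu]_(t in unitI R) (Num.min (g t) n%:R)%:E @[n --> \oo] -->
    \int[mu]_(t in unitI R) (g t)%:E)%E.
  have mE t : (Num.min (g t) n%:R)%:E @[n --> \oo] --> (g t)%:E.
    apply: cvg_near_cst; near=> n; rewrite min_l//.
    by near: n; exact: nbhs_infty_ger.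
  under eq_integral => t _ do rewrite -(cvg_lim (@ereal_hausdorff R) (mE t)).
  apply: cvg_monotone_convergence => //.
  - exact: measurable_unitI.
  - move=> n; apply/measurable_EFinP/measurable_funTS; exact: measurable_minr.
  - by move=> n t _; rewrite lee_fin le_min ltW/=.
  - move=> t _ m n mn; rewrite lee_fin le_min ge_min lexx/= ge_min.
    by apply/orP; right; rewrite ler_nat.
rewrite -(cvg_lim (@ereal_hausdorff R) cvgt); apply: lime_le.
  by apply/cvg_ex; eexists; exact: cvgt.
near=> n.
have := @comparison _ (integrable_trunc n) _ 1.
rewrite ler01 lexx primitive_unitI0 primitive_unitI1 => /(_ _ isT).
case: Ggam => _ _ _ -> _; rewrite subr0 -lee_fin fineK.
  apply => t /andP[t0 t1]; rewrite /trunc patchE mem_set ?ge_min ?lexx//.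
  by rewrite /unitI/= in_itv/= (ltW t0) ltW.
apply: integrable_fin_num; first exact: measurable_unitI.
have := integrable_trunc n; rewrite /trunc -restrict_EFin.
by move/((integrable_mkcond _ measurable_unitI).2).
Unshelve. all: by end_near. Qed.

(** Once g is known to be integrable, monotonicity applies to [gam - warp g] and to [warp g - gam],
    both of which vanish at 0; hence they are equal on I. *)
Lemma Gamma_density : exists2 h, [/\ density h, forall t, 0 < h t &
    forall t, 0 <= t <= 1 -> warp h t = gam t] &
  {ae mu, forall t, unitI R t -> derive1 gam t = h t}.
Proof.
have ig : mu.-integrable setT (EFin \o (g \_ (unitI R))).
  apply/integrable_patch_unitI; apply: ge0_integrable => //.
  - exact: measurable_unitI.
  - exact: measurable_funTS.
  - by move=> t _; exact: ltW.
  - by rewrite (le_lt_trans integral_g_le1)// ltry.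
have cg t : 0 <= t <= 1 -> warp g t = gam t.
  move=> /andP[t0 t1]; apply/eqP; rewrite eq_le; apply/andP; split.
    have := @comparison _ ig _ t; rewrite t0 t1 primitive_unitI0 subr0.
    apply => // s /andP[s0 s1]; rewrite patchE mem_set//.
    by rewrite /unitI/= in_itv/= (ltW s0) ltW.
  have : warp g 0 - gam 0 <= warp g t - gam t.
    apply: (@abs_continuous_nondecreasing _ 0 t (fun t => warp g t - gam t)) => //.
      apply: abs_continuousB; first exact: primitive_abs_continuous.
      exact: abs_continuous_sub acg.
    move: aeg (primitive_ae_derivable ig); apply: aeS2 => s H1 [dh dhE] /andP[s0 st].
    have s01 : 0 < s < 1 by rewrite s0 (lt_le_trans st).
    have [dg _ dgE] := H1 s01; split; first exact: derivableB.
    rewrite derive1E deriveB// -!derive1E dhE dgE subr_ge0 patchE mem_set//.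
    by case/andP : s01 => s0' s1; rewrite /unitI/= in_itv/= (ltW s0) ltW.
  by case: Ggam => _ _ -> _ _; rewrite /warp primitive_unitI0; lra.
exists g; last first.
  move: aeg (ae_interior 0 1); apply: aeS2 => t H1 H2.
  by rewrite /unitI/= in_itv/= => /H2/H1[].
split => //; split => //; first by move=> t; exact: ltW.
have := cg 1; rewrite ler01 lexx /warp primitive_unitI1 => /(_ isT).
case: Ggam => _ _ _ -> _; rewrite /Rintegral => g1; rewrite -g1 fineK//.
apply: integrable_fin_num; first exact: measurable_unitI.
by move/integrable_patch_unitI : ig.
Qed.

End from_Gamma.
End densities.

Section warp_theory.
Import HBNNSimple.
Context {R : realType}.
Notation mu := (@lebesgue_measure R).
Implicit Types g : R -> R.

Lemma density_ipatch g : density g ->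
  mu.-integrable setT (EFin \o (g \_ (unitI R))).
Proof. by move=> dg; apply/integrable_patch_unitI; exact: density_integrable. Qed.

Lemma warp0 g : warp g 0 = 0. Proof. exact: primitive_unitI0. Qed.

Lemma warp1 g : density g -> warp g 1 = 1.
Proof. by move=> [_ _ g1]; rewrite /warp primitive_unitI1 /Rintegral g1. Qed.

Lemma warp_continuous g : density g -> continuous (warp g).
Proof. by move=> dg; apply: primitive_continuous; exact: density_ipatch. Qed.

Lemma warp_measurable g : density g -> measurable_fun setT (warp g).
Proof. by move=> dg; apply: continuous_measurable_fun; exact: warp_continuous. Qed.

Lemma warp_nd g : density g -> {homo warp g : x y / x <= y}.
Proof.
move=> dg x y xy; rewrite -subr_ge0 primitiveB//; last exact: density_ipatch.
apply: Rintegral_ge0 => t _; rewrite patchE; case: ifPn => // _.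
by case: dg.
Qed.

Lemma warp_unitI g t : density g -> unitI R t -> unitI R (warp g t).
Proof.
move=> dg; rewrite /unitI/= !in_itv/= => /andP[t0 t1].
apply/andP; split; first by rewrite -[leLHS](warp0 g) warp_nd.
by rewrite -[leRHS](warp1 dg) warp_nd.
Qed.

Lemma subset_unitI (a b : R) : 0 <= a -> b <= 1 -> `[a, b] `<=` unitI R.
Proof.
move=> a0 b1 t; rewrite /unitI/= !in_itv/= => /andP[at_ tb].
by rewrite (le_trans a0)//= (le_trans tb).
Qed.

Lemma warpB g a b : density g -> 0 <= a -> a <= b -> b <= 1 ->
  (\int[mu]_(t in `[a, b]) (g t)%:E)%E = (warp g b - warp g a)%:E.
Proof.
move=> dg a0 ab b1; have abI := subset_unitI a0 b1.
have ig : mu.-integrable `[a, b] (EFin \o g).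
  by apply: integrableS (density_integrable dg) => //; exact: measurable_unitI.
rewrite (primitiveB (density_ipatch dg))//.
rewrite Rintegral_itv_obnd_cbnd; last first.
  by apply: integrableS (density_ipatch dg).
rewrite /Rintegral fineK; last first.
  by apply: integrable_fin_num => //; apply: integrableS (density_ipatch dg).
by apply: eq_integral => t /[!inE] tab; rewrite patchE mem_set//; exact: abI.
Qed.

Lemma warp_substitution g a b (f : R -> \bar R) : density g ->
  0 <= a -> a <= b -> b <= 1 ->
  measurable_fun `[warp g a, warp g b] f ->
  (forall y, warp g a <= y <= warp g b -> (0 <= f y)%E) ->
  (\int[mu]_(t in `[a, b]) (f (warp g t) * (g t)%:E) =
   \int[mu]_(y in `[warp g a, warp g b]) f y)%E.
Proof.
move=> dg a0 ab b1 mf f0; have [mg g0 _] := dg.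
apply: ge0_integral_substitution => //; first exact: warp_continuous.
move=> x y ax xy yb; apply: warpB => //; first exact: le_trans ax.
exact: le_trans b1.
Qed.

Lemma warp_substitution_unitI g (f : R -> \bar R) : density g ->
  measurable_fun (unitI R) f -> (forall y, unitI R y -> (0 <= f y)%E) ->
  (\int[mu]_(t in unitI R) (f (warp g t) * (g t)%:E) =
   \int[mu]_(y in unitI R) f y)%E.
Proof.
move=> dg mf f0.
have := @warp_substitution g 0 1 f dg (lexx 0) ler01 (lexx 1).
by rewrite warp0 (warp1 dg); apply.
Qed.

Lemma warp_ae_derivable g : density g -> {ae mu, forall t, unitI R t ->
  derivable (warp g) t 1 /\ derive1 (warp g) t = g t}.
Proof.
move=> /density_ipatch/primitive_ae_derivable; apply: aeS => t [dt ->] It.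
by split => //; rewrite patchE mem_set.
Qed.

Lemma warp_Gamma g : density g -> (forall t, 0 < g t) -> Gamma R (warp g).
Proof.
move=> dg g0; split.
- by move=> t It; exact: warp_unitI.
- by apply: primitive_abs_continuous; exact: density_ipatch.
- exact: warp0.
- exact: warp1.
- by move: (warp_ae_derivable dg); apply: aeS => t + It => /(_ It)[? ->].
Qed.

(* Unlike [ge0_ae_eq_integral], this applies to [act q gam], whose factor
   derive1 gam is not known to be measurable. *)
Lemma le_ae_ge0_integral (D : set R) (f1 f2 : R -> \bar R) :
  (forall t, D t -> (0 <= f1 t)%E) -> (forall t, D t -> (0 <= f2 t)%E) ->
  {ae mu, forall t, D t -> f1 t = f2 t} ->
  (\int[mu]_(t in D) f1 t <= \int[mu]_(t in D) f2 t)%E.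
Proof.
move=> f10 f20 [A [mA A0 f12]].
rewrite ge0_integralE// ge0_integralE//.
apply/ge_ereal_sup => /= _ [h hf1 <-].
have mAc : measurable (~` A) by exact: measurableC.
(* The integral of a nonnegative function is a supremum over the simple functions below it. Setting
   such a function to 0 on the null set keeps its integral and brings it below [f2]. *)
pose h' := mul_nnsfun h (indic_nnsfun R mAc).
have h'E t : h' t = h t * \1_(~` A) t by [].
have -> : sintegral mu h = sintegral mu h'.
  rewrite -!integralT_nnsfun; apply: ge0_ae_eq_integral => //.
  - by apply/measurable_EFinP; exact: measurable_funPT.
  - by apply/measurable_EFinP; exact: measurable_funPT.
  - by move=> t _; rewrite lee_fin.
  - by move=> t _; rewrite lee_fin.
  - exists A; split => // t /not_implyP[_]; apply: contra_notP => nA.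
    by have := h'E t; rewrite indicE mem_set// mulr1 => ->.
apply: ereal_sup_ubound; exists h' => // t.
rewrite h'E indicE; have [At|At] := pselect (A t).
  have -> : (t \in ~` A) = false by apply: memNset => /(_ At).
  rewrite mulr0.
  by rewrite patchE; case: ifPn => // /[!inE] /f20.
rewrite mem_set// mulr1; apply: le_trans (hf1 t) _.
rewrite !patchE; case: ifPn => // /[!inE] Dt.
by rewrite (_ : f1 t = f2 t)//; apply: contrapT => ne; apply: At; apply: f12 => /=; tauto.
Qed.

Lemma eq_ae_ge0_integral (D : set R) (f1 f2 : R -> \bar R) :
  (forall t, D t -> (0 <= f1 t)%E) -> (forall t, D t -> (0 <= f2 t)%E) ->
  {ae mu, forall t, D t -> f1 t = f2 t} ->
  (\int[mu]_(t in D) f1 t = \int[mu]_(t in D) f2 t)%E.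
Proof.
move=> f10 f20 f12; apply/eqP; rewrite eq_le !le_ae_ge0_integral//.
by move: f12; apply: aeS => t + Dt => /(_ Dt).
Qed.

End warp_theory.

(** * The space L^2 *)

Section cauchy_schwarz.
Context {R : realType}.
Notation mu := (@lebesgue_measure R).

(** The discriminant argument common to the scalar and the vector forms of Cauchy-Schwarz. *)
Lemma discriminant_bound (A B C : R) : 0 <= A -> 0 <= C ->
  (forall s, 0 <= A + 2 * s * B + s ^+ 2 * C) ->
  B <= Num.sqrt A * Num.sqrt C.
Proof.
move=> A0 C0 H; rewrite -sqrtrM//.
have [B0|B0] := leP B 0; first by rewrite (le_trans B0)// sqrtr_ge0.
rewrite -[leLHS](ger0_norm (ltW B0)) -sqrtr_sqr ler_sqrt ?mulr_ge0//.
have [C0'|Cn0] := eqVneq C 0.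
  (* When C = 0 the polynomial is affine of slope [2 * B > 0]; at this point it equals -1. *)
  have := H (- (A + 1) / (2 * B)); rewrite C0' mulr0 addr0.
  have -> : 2 * (- (A + 1) / (2 * B)) * B = - (A + 1) by field; lra.
  lra.
have {}C0 : 0 < C by rewrite lt_neqAle eq_sym Cn0.
have := H (- B / C).
have -> : A + 2 * (- B / C) * B + (- B / C) ^+ 2 * C = (A * C - B ^+ 2) / C.
  by field.
by rewrite pmulr_lge0 ?invr_gt0// subr_ge0.
Qed.

Lemma integrable_prod_sq (D : set (measurableTypeR R)) (f h : R -> R) : measurable D ->
  measurable_fun D f -> measurable_fun D h ->
  mu.-integrable D (fun t => (f t ^+ 2)%:E) ->
  mu.-integrable D (fun t => (h t ^+ 2)%:E) ->
  mu.-integrable D (fun t => (f t * h t)%:E).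
Proof.
move=> mD mf mh if2 ih2.
apply: (le_integrable mD _ _ (integrableD mD if2 ih2)).
- by apply/measurable_EFinP; exact: measurable_funM.
- move=> t _ /=; rewrite lee_fin.
  rewrite [leRHS]ger0_norm ?addr_ge0 ?sqr_ge0//.
  have := sqr_ge0 (f t - h t); have := sqr_ge0 (f t + h t).
  rewrite ler_norml; rewrite !expr2 => ? ?; apply/andP; split; nra.
Qed.

Lemma cauchy_schwarz_Rintegral (D : set (measurableTypeR R)) (f h : R -> R) : measurable D ->
  measurable_fun D f -> measurable_fun D h ->
  mu.-integrable D (fun t => (f t ^+ 2)%:E) ->
  mu.-integrable D (fun t => (h t ^+ 2)%:E) ->
  \int[mu]_(t in D) (f t * h t) <=
  Num.sqrt (\int[mu]_(t in D) (f t ^+ 2)) *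
  Num.sqrt (\int[mu]_(t in D) (h t ^+ 2)).
Proof.
move=> mD mf mh if2 ih2; apply: discriminant_bound.
- by apply: Rintegral_ge0 => t _; exact: sqr_ge0.
- by apply: Rintegral_ge0 => t _; exact: sqr_ge0.
move=> s.
have ifh := integrable_prod_sq mD mf mh if2 ih2.
have iZ (k : R) u : mu.-integrable D (EFin \o u) ->
    mu.-integrable D (EFin \o (fun t => k * u t)).
  by move=> iu; apply: (eq_integrable mD _ _ _ (integrableZl mD k iu)).
have -> : \int[mu]_(t in D) (f t ^+ 2) + 2 * s * \int[mu]_(t in D) (f t * h t) +
    s ^+ 2 * \int[mu]_(t in D) (h t ^+ 2) =
    \int[mu]_(t in D) ((f t + s * h t) ^+ 2).
  have e1 : \int[mu]_(t in D) (2 * s * (f t * h t)) =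
      2 * s * \int[mu]_(t in D) (f t * h t) by rewrite RintegralZl.
  have e2 : \int[mu]_(t in D) (s ^+ 2 * (h t ^+ 2)) =
      s ^+ 2 * \int[mu]_(t in D) (h t ^+ 2) by rewrite RintegralZl.
  rewrite -e1 -e2 -RintegralD//; last exact: iZ.
  rewrite -RintegralD//; [|exact: (integrableD mD if2 (iZ _ _ ifh))|exact: iZ].
  by apply: eq_Rintegral => t _; ring.
by apply: Rintegral_ge0 => t _; exact: sqr_ge0.
Qed.

End cauchy_schwarz.

Section L2_theory.
Context {R : realType} {N : nat}.
Notation mu := (@lebesgue_measure R).
Notation I := (unitI R).
Implicit Types q w u v : R -> 'rV[R]_N.

Let mI : measurable (I : set (measurableTypeR R)) := measurable_unitI.

Lemma L2_integrable_dot q w : L2 R N q -> L2 R N w ->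
  mu.-integrable I (EFin \o (fun t => \sum_(i < N) q t 0 i * w t 0 i)).
Proof.
move=> Lq Lw.
have H : mu.-integrable I (fun t => \sum_(i < N) (q t 0 i * w t 0 i)%:E)%E.
  apply: integrable_sum => // i _.
  have [mq iq] := Lq i; have [mw iw] := Lw i.
  exact: integrable_prod_sq.
by apply: eq_integrable H => // t _ /=; rewrite -sumEFin.
Qed.

Lemma L2D q w : L2 R N q -> L2 R N w -> L2 R N (fun t => q t + w t).
Proof.
move=> Lq Lw i; have [mq iq] := Lq i; have [mw iw] := Lw i.
have E : (fun t => (q t + w t) 0 i) = (fun t => q t 0 i + w t 0 i).
  by apply/funext => t; rewrite mxE.
split; first by rewrite E; exact: measurable_funD.
apply: (le_integrable mI _ _
  (integrableD mI (integrableZl mI 2 iq) (integrableZl mI 2 iw))).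
- by apply/measurable_EFinP; apply: measurable_funX; rewrite E; exact: measurable_funD.
- move=> t _ /=; rewrite lee_fin mxE.
  rewrite [leLHS]ger0_norm ?sqr_ge0// [leRHS]ger0_norm; last first.
    by apply: addr_ge0; apply: mulr_ge0 => //; exact: sqr_ge0.
  have := sqr_ge0 (q t 0 i - w t 0 i); rewrite !expr2; nra.
Qed.

Lemma L2Z (k : R) q : L2 R N q -> L2 R N (fun t => k *: q t).
Proof.
move=> Lq i; have [mq iq] := Lq i.
have E : (fun t => (k *: q t) 0 i) = (fun t => k * q t 0 i).
  by apply/funext => t; rewrite mxE.
split; first by rewrite E; exact: measurable_funM.
have := integrableZl mI (k ^+ 2) iq; apply: eq_integrable => // t _.
by rewrite mxE exprMn EFinM.
Qed.

Lemma L2B q w : L2 R N q -> L2 R N w -> L2 R N (fun t => q t - w t).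
Proof.
move=> Lq /(L2Z (-1)) Lw; have := L2D Lq Lw.
by under eq_fun do rewrite scaleN1r.
Qed.

Lemma l2dotC q w : l2dot q w = l2dot w q.
Proof. by apply: eq_Rintegral => t _; apply: eq_bigr => i _; rewrite mulrC. Qed.

Lemma l2dotDl q w u : L2 R N q -> L2 R N w -> L2 R N u ->
  l2dot (fun t => q t + w t) u = l2dot q u + l2dot w u.
Proof.
move=> Lq Lw Lu; rewrite /l2dot -RintegralD//; [|exact: L2_integrable_dot..].
by apply: eq_Rintegral => t _; rewrite -big_split/=; apply: eq_bigr => i _; rewrite mxE mulrDl.
Qed.

Lemma l2dotZl k q u : L2 R N q -> L2 R N u ->
  l2dot (fun t => k *: q t) u = k * l2dot q u.
Proof.
move=> Lq Lu; rewrite /l2dot -RintegralZl//; last exact: L2_integrable_dot.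
by apply: eq_Rintegral => t _; rewrite mulr_sumr; apply: eq_bigr => i _; rewrite mxE mulrA.
Qed.

Lemma l2dot_ge0 q : 0 <= l2dot q q.
Proof.
apply: Rintegral_ge0 => t _; apply: sumr_ge0 => i _.
by rewrite -expr2 sqr_ge0.
Qed.

Lemma l2dotDD q w (s : R) : L2 R N q -> L2 R N w ->
  l2dot (fun t => q t + s *: w t) (fun t => q t + s *: w t) =
  l2dot q q + 2 * s * l2dot q w + s ^+ 2 * l2dot w w.
Proof.
move=> Lq Lw; have Lsw := L2Z s Lw; have Lqw := L2D Lq Lsw.
rewrite l2dotDl// l2dotC (l2dotC (fun t => s *: w t)) !l2dotDl//.
rewrite !l2dotZl// (l2dotC _ (fun t => s *: w t)) !l2dotZl// (l2dotC w q).
rewrite (l2dotC w (fun t => s *: w t)) l2dotZl//.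
ring.
Qed.

Lemma l2dot_le q w : L2 R N q -> L2 R N w -> l2dot q w <= l2norm q * l2norm w.
Proof.
move=> Lq Lw; apply: discriminant_bound; [exact: l2dot_ge0..|move=> s].
by rewrite -l2dotDD// l2dot_ge0.
Qed.

Lemma l2dist_sqr q w : L2 R N q -> L2 R N w ->
  l2dist q w ^+ 2 = l2dot q q + l2dot w w - 2 * l2dot q w.
Proof.
move=> Lq Lw; rewrite /l2dist /l2norm sqr_sqrtr ?l2dot_ge0//.
have := l2dotDD (-1) Lq Lw.
under eq_fun do rewrite scaleN1r.
move=> ->; ring.
Qed.

Lemma l2distC q w : l2dist q w = l2dist w q.
Proof.
congr Num.sqrt; apply: eq_Rintegral => t _; apply: eq_bigr => i _.
by rewrite !mxE; ring.
Qed.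

Lemma l2dist_ge0 q w : 0 <= l2dist q w. Proof. exact: sqrtr_ge0. Qed.

Lemma l2norm_triangle q w : L2 R N q -> L2 R N w ->
  l2norm (fun t => q t + w t) <= l2norm q + l2norm w.
Proof.
move=> Lq Lw; rewrite -(@ler_pXn2r _ 2)// ?nnegrE ?addr_ge0 ?sqrtr_ge0//.
have := l2dotDD 1 Lq Lw.
under eq_fun do rewrite scale1r.
have sq u : l2norm u ^+ 2 = l2dot u u by rewrite sqr_sqrtr// l2dot_ge0.
rewrite -sq sqrrD !sq => ->; have := l2dot_le Lq Lw; rewrite mulr2n; lra.
Qed.

Lemma l2dist_triangle v q w : L2 R N q -> L2 R N v -> L2 R N w ->
  l2dist q w <= l2dist q v + l2dist v w.
Proof.
move=> Lq Lv Lw; have := l2norm_triangle (L2B Lq Lv) (L2B Lv Lw).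
by under eq_fun do rewrite subrKA.
Qed.

Lemma l2dist_ae u q w : {ae mu, forall t, I t -> q t = w t} ->
  l2dist u q = l2dist u w.
Proof.
move=> qw; congr Num.sqrt; rewrite /l2dot /Rintegral; congr fine.
apply: eq_ae_ge0_integral.
- by move=> t _; rewrite lee_fin; apply: sumr_ge0 => i _; rewrite -expr2 sqr_ge0.
- by move=> t _; rewrite lee_fin; apply: sumr_ge0 => i _; rewrite -expr2 sqr_ge0.
by move: qw; apply: aeS => t + It => /(_ It) ->.
Qed.

End L2_theory.

(** * The action on L^2 *)

Section measurable_operations.
Context {R : realType}.

Lemma measurable_sqrt : measurable_fun setT (@Num.sqrt R).
Proof. by apply: continuous_measurable_fun; exact: sqrt_continuous. Qed.

Lemma measurable_inv_gt0 (f : R -> R) : measurable_fun setT f ->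
  (forall t, 0 < f t) -> measurable_fun setT (fun t => (f t)^-1).
Proof.
move=> mf f0.
apply: (@measurable_comp _ _ _ _ _ _ (`]0, +oo[%classic : set R) (@GRing.inv R) setT f) => //.
  by move=> _ [t _ <-]; rewrite /= in_itv/= andbT.
apply: open_continuous_measurable_fun; first exact: interval_open.
move=> x; rewrite inE/= in_itv/= andbT => x0.
by apply: inv_continuous; rewrite gt_eqF.
Qed.

End measurable_operations.

Section pull.
Context {R : realType} {N : nat}.
Notation mu := (@lebesgue_measure R).
Notation I := (unitI R).
Implicit Types (q w u v : R -> 'rV[R]_N) (g h : R -> R).

Definition pull q g : R -> 'rV[R]_N := fun t => Num.sqrt (g t) *: q (warp g t).

Let mI : measurable (I : set (measurableTypeR R)) := measurable_unitI.

Lemma measurable_warp_comp g (f : R -> R) : density g ->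
  measurable_fun I f -> measurable_fun I (fun t => f (warp g t)).
Proof.
move=> dg mf; apply: (measurable_comp mI _ mf).
  by move=> _ [t It <-]; exact: warp_unitI.
exact: measurable_funTS (warp_measurable dg).
Qed.

Lemma pull_sqr q g t i : 0 <= g t ->
  pull q g t 0 i ^+ 2 = q (warp g t) 0 i ^+ 2 * g t.
Proof. by move=> g0; rewrite mxE exprMn sqr_sqrtr// mulrC. Qed.

Lemma L2_pull q g : density g -> L2 R N q -> L2 R N (pull q g).
Proof.
move=> dg Lq i; have [mg g0 _] := dg; have [mq iq] := Lq i.
have mp : measurable_fun I (fun t => pull q g t 0 i).
  have -> : (fun t => pull q g t 0 i) =
      (fun t => Num.sqrt (g t) * q (warp g t) 0 i).
    by apply/funext => t; rewrite mxE.
  apply: measurable_funM; last exact: (@measurable_warp_comp g (fun t => q t 0 i)).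
  exact: measurable_funTS (measurableT_comp measurable_sqrt mg).
split => //; apply: ge0_integrable => //.
- exact: measurable_funX.
- by move=> t _; exact: sqr_ge0.
- under eq_integral do rewrite pull_sqr// EFinM.
  rewrite (@warp_substitution_unitI _ g (fun y => (q y 0 i ^+ 2)%:E))//.
  + exact: integrable_lty.
  + exact: measurable_int iq.
  + by move=> y _; rewrite lee_fin sqr_ge0.
Qed.

Lemma l2dot_pull q g : density g -> L2 R N q ->
  l2dot (pull q g) (pull q g) = l2dot q q.
Proof.
move=> dg Lq; have [mg g0 _] := dg; rewrite /l2dot /Rintegral; congr fine.
rewrite -(@warp_substitution_unitI _ g
  (fun y => (\sum_(i < N) q y 0 i * q y 0 i)%:E))//.
- apply: eq_integral => t _; rewrite -EFinM mulr_suml; congr EFin.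
  by apply: eq_bigr => i _; rewrite -!expr2 pull_sqr.
- exact: measurable_int (L2_integrable_dot Lq Lq).
- by move=> y _; rewrite lee_fin sumr_ge0// => i _; rewrite -expr2 sqr_ge0.
Qed.

Lemma l2dist_pull q w g : density g -> L2 R N q -> L2 R N w ->
  l2dist (pull q g) (pull w g) = l2dist q w.
Proof.
move=> dg Lq Lw; rewrite /l2dist /l2norm; congr Num.sqrt.
rewrite -[RHS](l2dot_pull dg (L2B Lq Lw)).
by apply: eq_Rintegral => t _; apply: eq_bigr => i _; rewrite -scalerBr.
Qed.

(** The speed of [warp g \o warp h] given by the chain rule. *)
Definition density_comp g h t := g (warp h t) * h t.

Lemma warpE g x : density g -> 0 <= x <= 1 ->
  (\int[mu]_(t in `[0%R, x]) (g t)%:E)%E = (warp g x)%:E.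
Proof. by move=> dg /andP[x0 x1]; rewrite warpB// warp0 subr0. Qed.

Lemma measurable_density_comp g h : density g -> density h ->
  measurable_fun setT (density_comp g h).
Proof.
move=> [mg _ _] dh; have [mh _ _] := dh; apply: measurable_funM => //.
exact: measurableT_comp mg (warp_measurable dh).
Qed.

Lemma integral_density_comp g h x : density g -> density h -> 0 <= x <= 1 ->
  (\int[mu]_(t in `[0%R, x]) (density_comp g h t)%:E)%E = (warp g (warp h x))%:E.
Proof.
move=> dg dh /andP[x0 x1]; have [mg g0 _] := dg.
under eq_integral do rewrite EFinM.
rewrite (@warp_substitution _ h 0 x (EFin \o g))// ?warp0.
- rewrite warpE//; have : I (warp h x).
    by apply: warp_unitI => //; rewrite /unitI/= in_itv/= x0.
  by rewrite /unitI/= in_itv/=.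
- by apply/measurable_EFinP; exact: measurable_funTS.
- by move=> y _; rewrite lee_fin.
Qed.

Lemma density_comp_density g h : density g -> density h ->
  density (density_comp g h).
Proof.
move=> dg dh; have [_ g0 _] := dg; have [_ h0 _] := dh; split.
- exact: measurable_density_comp.
- by move=> t; exact: mulr_ge0.
- by rewrite integral_density_comp// ?ler01 ?lexx// (warp1 dh) (warp1 dg).
Qed.

Lemma warp_comp g h x : density g -> density h -> 0 <= x <= 1 ->
  warp (density_comp g h) x = warp g (warp h x).
Proof.
move=> dg dh x01; apply: EFin_inj; rewrite -warpE//.
  exact: integral_density_comp.
exact: density_comp_density.
Qed.

Lemma pull_comp q g h t : density g -> density h -> I t ->
  pull (pull q g) h t = pull q (density_comp g h) t.
Proof.
move=> dg dh; rewrite /unitI/= in_itv/= => t01; have [_ g0 _] := dg.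
by rewrite /pull scalerA mulrC -sqrtrM// warp_comp.
Qed.

End pull.

(** * Inverse of a reparametrization of positive speed *)

Section inverse.
Context {R : realType}.
Notation mu := (@lebesgue_measure R).
Notation I := (unitI R).

Variable g : R -> R.
Hypotheses (dg : density g) (g_gt0 : forall t, 0 < g t).

Let mg : measurable_fun setT g. Proof. by case: dg. Qed.

Lemma warp_lt x y : 0 <= x -> x < y -> y <= 1 -> warp g x < warp g y.
Proof.
move=> x0 xy y1; rewrite lt_neqAle warp_nd ?ltW// andbT; apply/eqP => E.
have := warpB dg x0 (ltW xy) y1; rewrite E subrr => int0.
have : (\int[mu]_(t in `[x, y]) `|(g t)%:E| = 0)%E.
  by under eq_integral do rewrite gee0_abs ?lee_fin ?ltW//.
move/ae_eq_integral_abs => /(_ _ _)[]//.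
  exact/measurable_EFinP/measurable_funTS.
move=> A [mA A0 sA].
have : (mu `[x, y] <= mu A)%E.
  apply: le_measure; rewrite ?inE// => t txy; apply: sA => /=.
  by move=> /(_ txy) [] /eqP; rewrite gt_eqF.
by rewrite A0 lebesgue_measure_itv/= lte_fin xy -EFinB lee_fin; lra.
Qed.

Let warp_surj y : exists x, 0 <= x <= 1 /\ (0 <= y <= 1 -> warp g x = y).
Proof.
have [y01|ny01] := boolP (0 <= y <= 1); last by exists 0; rewrite lexx ler01.
have [||x] := @IVT R (warp g) 0 1 y ler01.
- exact: continuous_subspaceT (warp_continuous dg).
- by rewrite warp0 (warp1 dg) min_l ?ler01// max_r ?ler01.
by rewrite in_itv/= => x01 <-; exists x.
Qed.

(** The inverse of [warp g], extended by constants: it is then nondecreasing on the whole line,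
    hence measurable. *)
Let H y := projT1 (cid (warp_surj (clamp 0 1 y))).

Let clamp01 (y : R) : 0 <= clamp 0 1 y <= 1.
Proof. by rewrite /clamp le_max lexx/= ge_max ler01 ge_min lexx. Qed.

Let H01 y : 0 <= H y <= 1.
Proof. by have [] := projT2 (cid (warp_surj (clamp 0 1 y))). Qed.

Let HK y : warp g (H y) = clamp 0 1 y.
Proof. by have [_ /(_ (clamp01 y))] := projT2 (cid (warp_surj (clamp 0 1 y))). Qed.

Let KH x : 0 <= x <= 1 -> H (warp g x) = x.
Proof.
move=> x01; have := HK (warp g x).
have wx : 0 <= warp g x <= 1.
  by have := @warp_unitI _ g x dg; rewrite /unitI/= !in_itv/=; apply.
rewrite clamp_id// => E; have := H01 (warp g x).
move: x01 E => /andP[x0 x1] E /andP[h0 h1].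
have [lt|lt|//] := ltgtP (H (warp g x)) x.
  by have := warp_lt h0 lt x1; rewrite E ltxx.
by have := warp_lt x0 lt h1; rewrite E ltxx.
Qed.

Let H_nd : {homo H : x y / x <= y}.
Proof.
move=> x y xy; rewrite leNgt; apply/negP => lt.
have /andP[y0 _] := H01 y; have /andP[_ x1] := H01 x.
have := warp_lt y0 lt x1; rewrite !HK ltNge => /negP; apply.
rewrite /clamp ge_max le_max lexx/= le_max; apply/orP; right.
by rewrite le_min !ge_min lexx xy orbT.
Qed.

Let mH : measurable_fun setT H.
Proof. exact: nondecreasing_measurable. Qed.

Let h y := (g (H y))^-1.

Let h_gt0 y : 0 < h y. Proof. by rewrite invr_gt0. Qed.

Let mh : measurable_fun setT h.
Proof. by apply: measurable_inv_gt0 => //; exact: measurableT_comp. Qed.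

(** Substituting along [warp g] turns h into the constant 1 on [0, H y]; thus h is the speed of H,
    and H never has to be differentiated. *)
Let integral_h y : 0 <= y <= 1 -> (\int[mu]_(t in `[0%R, y]) (h t)%:E)%E = (H y)%:E.
Proof.
move=> y01; have /andP[Hy0 Hy1] := H01 y.
have := @warp_substitution _ g 0 (H y) (EFin \o h) dg (lexx 0) Hy0 Hy1.
rewrite warp0 HK clamp_id// => <-; last 2 first.
- by apply/measurable_EFinP; exact: measurable_funTS.
- by move=> t _; rewrite lee_fin ltW.
under eq_integral => t.
  rewrite inE/= in_itv/= => /andP[t0 tH].
  rewrite -EFinM /h KH ?t0 ?(le_trans tH)// mulVf ?gt_eqF//; over.
rewrite integral_cst// mul1e [LHS]lebesgue_measure_itv/= lte_fin.
by case: ltgtP Hy0 => // [_|<-]; rewrite ?sube0.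
Qed.

(** The last clause is the chain rule for the identity. It holds at every point, so pulling back by
    g and then by h gives back the original function everywhere on I. *)
Lemma inverse_density : exists h, [/\ density h, forall t, 0 < h t,
  forall y, 0 <= y <= 1 -> warp g (warp h y) = y &
  forall y, 0 <= y <= 1 -> g (warp h y) * h y = 1].
Proof.
have dh : density h.
  split=> //; first by move=> t; exact: ltW.
  rewrite integral_h ?ler01 ?lexx// -[in H 1](warp1 dg) KH ?ler01 ?lexx//.
have warphE y : 0 <= y <= 1 -> warp h y = H y.
  by move=> y01; apply: EFin_inj; rewrite -warpE// integral_h.
exists h; split => // y y01; rewrite warphE//; first by rewrite HK clamp_id.
by rewrite mulfV// gt_eqF.
Qed.

End inverse.

Section shape.
Context {R : realType} {N : nat}.
Notation mu := (@lebesgue_measure R).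
Notation I := (unitI R).
Implicit Types (q w u v : R -> 'rV[R]_N) (g h : R -> R).

(** In both directions [act] and [pull] agree almost everywhere on I, and [l2dist] does not see null
    sets. *)
Lemma shapeP q w : Defs.shape q w <-> L2 R N w /\ forall e : R, 0 < e ->
  exists g, [/\ density g, forall t, 0 < g t & l2dist w (pull q g) < e].
Proof.
split=> [[Lw cw]|[Lw cw]]; split => // e e0.
  have [_ [gam Ggam <-] wg] := cw e e0.
  have [g [dg g0 gE] aeg] := Gamma_density Ggam.
  have E : {ae mu, forall t, I t -> act q gam t = pull q g t}.
    move: aeg; apply: aeS => t + It => /(_ It) E.
    rewrite /act /pull E (gE t)//.
  by exists g; split; [exact: dg|exact: g0|rewrite -(l2dist_ae w E)].
have [g [dg g0 wg]] := cw e e0.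
have E : {ae mu, forall t, I t -> act q (warp g) t = pull q g t}.
  move: (warp_ae_derivable dg); apply: aeS => t + It => /(_ It)[_ E].
  by rewrite /act /pull E.
exists (act q (warp g)); last by rewrite (l2dist_ae w E).
by exists (warp g); first exact: warp_Gamma.
Qed.

End shape.

(** * Closed orbits are stable under weak reparametrizations *)

Section approximation.
Context {R : realType}.
Notation mu := (@lebesgue_measure R).
Notation I := (unitI R).

Let mI : measurable (I : set (measurableTypeR R)) := measurable_unitI.

Lemma Rintegral_dominated_cvg0 (D : set (measurableTypeR R))
    (F : nat -> R -> R) (G : R -> R) : measurable D ->
  (forall n, measurable_fun D (F n)) ->
  (forall t, D t -> F n t @[n --> \oo] --> (0 : R)) ->
  mu.-integrable D (EFin \o G) ->
  (forall n t, D t -> `|F n t| <= G t) ->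
  (\int[mu]_(t in D) F n t) @[n --> \oo] --> (0 : R).
Proof.
move=> mD mF F0 iG FG.
have mFe n : measurable_fun D (fun t => (F n t)%:E) by exact/measurable_EFinP.
have m0 : measurable_fun D (cst (0 : \bar R)%E) by exact: measurable_cst.
have F0e : {ae mu, forall t, D t -> (fun n => (F n t)%:E) @ \oo --> (0 : \bar R)%E}.
  apply: aeW => t Dt; apply: cvg_EFin; [exact: nearW|exact: F0].
have FGe : {ae mu, forall t n, D t -> (`|(F n t)%:E| <= (EFin \o G) t)%E}.
  by apply: aeW => t n Dt; rewrite /= lee_fin FG.
have [_ _] := dominated_convergence mD mFe m0 F0e iG FGe.
rewrite integral0 => /fine_cvgP[_]; exact.
Qed.

Lemma clamp_cvg_id (x : R) : \forall n \near \oo, clamp (- n%:R) n%:R x = x.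
Proof.
near=> n; rewrite clamp_id// -ler_norml; near: n; exact: nbhs_infty_ger.
Unshelve. all: by end_near. Qed.

Lemma cvg_clamp (f : R -> R) t : clamp (- n%:R) n%:R (f t) @[n --> \oo] --> f t.
Proof.
by apply: cvg_near_cst; exact: clamp_cvg_id.
Qed.

Lemma clamp_normr (M x : R) : 0 <= M -> `|clamp (- M) M x| <= M.
Proof. by move=> M0; rewrite ler_norml; apply: clamp_in; lra. Qed.

Lemma clamp_center (M x : R) : 0 <= M -> `|clamp (- M) M x| <= `|x|.
Proof.
move=> M0; have := clamp_lipschitz (- M) M x 0.
by rewrite [clamp _ _ 0]clamp_id ?subr0//; apply/andP; split; lra.
Qed.

Lemma measurable_clamp (D : set (measurableTypeR R)) (f : R -> R) a b :
  measurable_fun D f -> measurable_fun D (fun t => clamp a b (f t)).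
Proof. by move=> mf; apply: measurable_maxr => //; exact: measurable_minr. Qed.

Lemma continuous_clamp a b : continuous (@clamp R a b).
Proof.
move=> y; apply/cvgrPdist_lt => d d0; near=> z.
apply: le_lt_trans (clamp_lipschitz _ _ _ _) _.
by near: z; apply/nbhs_ballP; exists d.
Unshelve. all: by end_near. Qed.

(** After truncation at height n, approximation in L^1 is enough: two values of absolute value at
    most n differ by at most 2 n, so the square of their difference is at most 2 n times the
    difference. Truncating the approximant also makes it bounded. *)
Lemma L2_continuous_approx (f : R -> R) (e : R) : measurable_fun I f ->
  mu.-integrable I (fun t => (f t ^+ 2)%:E) -> 0 < e ->
  exists p : R -> R, [/\ continuous p, exists M, forall t, `|p t| <= M &
    \int[mu]_(t in I) ((f t - p t) ^+ 2) < e].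
Proof.
move=> mf if2 e0.
pose c n (x : R) := clamp (- n%:R) n%:R x.
have mc n : measurable_fun I (fun t => c n (f t)) by exact: measurable_clamp.
have sqn (x : R) : `|x| ^+ 2 = x ^+ 2 by rewrite real_normK ?num_real.
have e4 : 0 < e / 4 by rewrite divr_gt0.
have bnd n t : (f t - c n (f t)) ^+ 2 <= 4 * f t ^+ 2.
  have -> : 4 * f t ^+ 2 = (2 * `|f t|) ^+ 2 by rewrite exprMn sqn; ring.
  rewrite -[leLHS]sqn ler_pXn2r ?nnegrE ?mulr_ge0//.
  have := @clamp_center n%:R (f t) (ler0n _ _).
  by have := ler_normB (f t) (c n (f t)); rewrite /c; lra.
have i4 : mu.-integrable I (EFin \o (fun t => 4 * f t ^+ 2)).
  exact: (integrableZl mI 4 if2).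
have cvg1 : \int[mu]_(t in I) ((f t - c n (f t)) ^+ 2) @[n --> \oo] --> (0 : R).
  apply: (@Rintegral_dominated_cvg0 _ _ (fun t => 4 * f t ^+ 2)) => //.
  - by move=> n; apply: measurable_funX; apply: measurable_funB => //; exact: mc.
  - move=> t _; have -> : 0 = (f t - f t) ^+ 2 :> R by rewrite subrr expr0n.
    have cf : c n (f t) @[n --> \oo] --> f t by exact: cvg_clamp.
    rewrite expr2; under eq_fun do rewrite expr2.
    by apply: cvgM; apply: cvgB => //; exact: cvg_cst.
  - by move=> n t _; rewrite ger0_norm ?sqr_ge0.
have /cvgr_dist_lt /(_ _ e4) := cvg1; move=> [n _ /(_ n (leqnn n))] /=.
rewrite sub0r normrN => fn.
have icn : mu.-integrable I (EFin \o (fun t => c n (f t))).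
  apply: measurable_bounded_integrable => //; [exact: unitI_lty|exact: mc|].
  exists n%:R; split; first exact: num_real.
  move=> x nx t _ /=; rewrite (le_trans _ (ltW nx))//; exact: clamp_normr.
have [g [cg ig gcvg]] := approximation_continuous_integrable mI unitI_lty icn.
(* The estimate [key] below gives an error of at most 2 times [e / 4] plus [4 * n%:R * eta]; [n.+1]
   avoids dividing by 0. *)
pose eta := e / (8 * n.+1%:R).
have eta0 : 0 < eta by rewrite divr_gt0// mulr_gt0// ltr0n.
have := gcvg => /fine_cvgP[_ /cvgr_dist_lt /(_ _ eta0)].
move=> [k _ /(_ k (leqnn k))] /=.
rewrite sub0r normrN => gk.
exists (fun t => c n (g k t)); split.
- move=> x.
  have cc : continuous (c n) by exact: continuous_clamp.
  exact: (continuous_comp (cg k x) (cc (g k x))).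
- by exists n%:R => t; exact: clamp_normr.
have ign : mu.-integrable I (EFin \o (fun t => `|c n (f t) - g k t|)).
  have H : mu.-integrable I (EFin \o (fun t => c n (f t) - g k t)).
    exact: (integrableB mI icn (ig k)).
  exact: (integrable_norm H).
have mgk : measurable_fun I (g k) by have /integrableP[/measurable_EFinP] := ig k.
have mcg : measurable_fun I (fun t => c n (g k t)) by exact: measurable_clamp.
have key t : (f t - c n (g k t)) ^+ 2 <=
    2 * (f t - c n (f t)) ^+ 2 + 4 * n%:R * `|c n (f t) - g k t|.
  set a := f t; set b := c n a; set d := c n (g k t).
  have h1 : `|b - d| <= `|b - g k t|.
    have bb : b = c n b by rewrite [RHS]/c clamp_id// -ler_norml clamp_normr.
    by rewrite {1}bb; exact: clamp_lipschitz.
  have h2 : `|b - d| <= 2 * n%:R.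
    have := ler_normB b d; have := @clamp_normr n%:R a (ler0n _ _).
    have := @clamp_normr n%:R (g k t) (ler0n _ _); rewrite -/(c n a) -/(c n (g k t)) -/b -/d; lra.
  have h3 : (b - d) ^+ 2 <= 2 * n%:R * `|b - g k t|.
    by rewrite -sqn expr2 ler_pM.
  have := sqr_ge0 (a - b - (b - d)); move: h3; rewrite !expr2; nra.
have i0 : mu.-integrable I (EFin \o (fun t => (f t - c n (f t)) ^+ 2)).
  apply: (le_integrable mI _ _ i4).
    by apply/measurable_EFinP; apply: measurable_funX; apply: measurable_funB => //; exact: mc.
  by move=> t _ /=; rewrite lee_fin !ger0_norm ?sqr_ge0// mulr_ge0// sqr_ge0.
have i1 : mu.-integrable I (EFin \o (fun t => 2 * (f t - c n (f t)) ^+ 2)).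
  exact: (integrableZl mI 2 i0).
have i2 : mu.-integrable I (EFin \o (fun t => 4 * n%:R * `|c n (f t) - g k t|)).
  exact: (integrableZl mI (4 * n%:R) ign).
have i3 : mu.-integrable I (EFin \o (fun t => (f t - c n (g k t)) ^+ 2)).
  apply: (le_integrable mI _ _ (integrableD mI i1 i2)).
    by apply/measurable_EFinP; apply: measurable_funX; apply: measurable_funB => //; exact: mcg.
  move=> t _ /=; rewrite lee_fin ger0_norm ?sqr_ge0// (le_trans (key t))//.
  exact: ler_norm.
apply: le_lt_trans (le_Rintegral mI i3 (integrableD mI i1 i2) (fun t _ => key t)) _.
rewrite RintegralD// !RintegralZl//.
move: fn gk; rewrite -/(Rintegral _ _ _).
move=> /(le_lt_trans (ler_norm _)) hA /(le_lt_trans (ler_norm _)) hB.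
have hn : 4 * n%:R * eta <= e / 2.
  rewrite /eta mulrA ler_pdivrMr ?mulr_gt0 ?ltr0n// -natr1.
  have : 0 <= n%:R * e by rewrite mulr_ge0// ltW.
  lra.
have := ler_wpM2l (mulr_ge0 (ler0n R 4) (ler0n R n)) (ltW hB).
lra.
Qed.

End approximation.

Section weak_reparametrization.
Context {R : realType} {N : nat}.
Notation mu := (@lebesgue_measure R).
Notation I := (unitI R).
Implicit Types (q w u v : R -> 'rV[R]_N) (g h : R -> R).

Let mI : measurable (I : set (measurableTypeR R)) := measurable_unitI.

Lemma l2dot_sum q w : L2 R N q -> L2 R N w ->
  l2dot q w = \sum_(i < N) \int[mu]_(t in I) (q t 0 i * w t 0 i).
Proof.
move=> Lq Lw.
have iqw i : mu.-integrable I (EFin \o (fun t => q t 0 i * w t 0 i)).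
  have [mq iq] := Lq i; have [mw iw] := Lw i; exact: integrable_prod_sq.
have E : (\int[mu]_(t in I) (\sum_(i < N) q t 0 i * w t 0 i)%:E =
    \sum_(i < N) \int[mu]_(t in I) (q t 0 i * w t 0 i)%:E)%E.
  by rewrite -integral_sum//; apply: eq_integral => t _; rewrite sumEFin.
rewrite /l2dot {1}/Rintegral E.
rewrite (_ : (\sum_(i < N) _)%E =
    (\sum_(i < N) \int[mu]_(t in I) (q t 0 i * w t 0 i))%:E)//.
rewrite -sumEFin; apply: eq_bigr => i _; rewrite /Rintegral fineK//.
exact: (integrable_fin_num mI (iqw i)).
Qed.

(** Cutting [e ^+ 2] into [N.+1] shares for N coordinates leaves one to spare, so the inequality
    stays strict, also for N = 0. *)
Lemma l2dist_lt q w (e : R) : L2 R N q -> L2 R N w -> 0 < e ->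
  (forall i, \int[mu]_(t in I) ((q t 0 i - w t 0 i) ^+ 2) < e ^+ 2 / N.+1%:R) ->
  l2dist q w < e.
Proof.
move=> Lq Lw e0 H; rewrite -(ger0_norm (ltW e0)) -sqrtr_sqr ltr_sqrt ?exprn_gt0//.
have Lqw := L2B Lq Lw; rewrite l2dot_sum//.
apply: (@le_lt_trans _ _ (\sum_(i < N) e ^+ 2 / N.+1%:R)).
  apply: ler_sum => i _; apply: le_trans (ltW (H i)).
  by rewrite le_eqVlt; apply/orP; left; apply/eqP; apply: eq_Rintegral => t _; rewrite !mxE expr2.
rewrite sumr_const card_ord -[X in X < _]mulr_natr -mulrA -[ltRHS]mulr1.
rewrite ltr_pM2l ?exprn_gt0// mulrC ltr_pdivrMr ?ltr0n// mul1r ltr_nat//.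
Qed.

Lemma L2_bounded q M : (forall i, continuous (fun t => q t 0 i)) ->
  (forall i t, `|q t 0 i| <= M) -> L2 R N q.
Proof.
move=> cq qM i.
have mq : measurable_fun I (fun t => q t 0 i).
  by apply: measurable_funTS; exact: continuous_measurable_fun.
split => //; apply: (@measurable_bounded_integrable _ _ R mu (fun t => q t 0 i ^+ 2)) => //.
- exact: unitI_lty.
- exact: measurable_funX.
- exists (M ^+ 2); split; first exact: num_real.
  move=> x Mx t _ /=; rewrite ger0_norm ?sqr_ge0// (le_trans _ (ltW Mx))//.
  by rewrite -[leLHS]real_normK ?num_real// ler_pXn2r ?nnegrE// (le_trans _ (qM i t)).
Qed.

Lemma L2_continuous_rV_approx q (e : R) : L2 R N q -> 0 < e ->
  exists p : R -> 'rV[R]_N, [/\ forall i, continuous (fun t => p t 0 i),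
    exists M, forall i t, `|p t 0 i| <= M & l2dist q p < e].
Proof.
move=> Lq e0; have d0 : 0 < e ^+ 2 / N.+1%:R by rewrite divr_gt0// exprn_gt0.
have app i : exists p : R -> R, [/\ continuous p, exists M, forall t, `|p t| <= M &
    \int[mu]_(t in I) ((q t 0 i - p t) ^+ 2) < e ^+ 2 / N.+1%:R].
  by have [mq iq] := Lq i; exact: L2_continuous_approx.
have [P HP] := choice app.
pose p t : 'rV[R]_N := \row_i P i t.
have pE i t : p t 0 i = P i t by rewrite mxE.
have cp i : continuous (fun t => p t 0 i).
  by under eq_fun do rewrite pE; have [] := HP i.
have bM i : exists m, forall t, `|P i t| <= m by have [] := HP i.
have [M0 HM] := choice bM.
have bp i t : `|p t 0 i| <= \sum_(j < N) `|M0 j|.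
  rewrite pE (le_trans (HM i t))// (le_trans (ler_norm _))//.
  by rewrite (bigD1 i)//= lerDl sumr_ge0.
exists p; split => //; first by exists (\sum_(j < N) `|M0 j|).
apply: l2dist_lt => //; first exact: L2_bounded bp.
by move=> i; under eq_Rintegral do rewrite pE; have [] := HP i.
Qed.

End weak_reparametrization.

Section mix.
Context {R : realType}.
Notation mu := (@lebesgue_measure R).
Notation I := (unitI R).

Let mI : measurable (I : set (measurableTypeR R)) := measurable_unitI.

Variable g : R -> R.
Hypothesis dg : density g.

Let g0 t : 0 <= g t. Proof. by case: dg. Qed.
Let mg : measurable_fun setT g. Proof. by case: dg. Qed.

(** The shift by 2 puts [c n] strictly between 0 and 1 already for n = 0. *)
Let c (n : nat) : R := n.+2%:R^-1.

Let c_gt0 n : 0 < c n. Proof. by rewrite invr_gt0 ltr0n. Qed.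

Let c_lt1 n : c n < 1.
Proof. by rewrite invf_lt1 ?ltr0n// ltr1n. Qed.

Let c_cvg0 : c n @[n --> \oo] --> (0 : R).
Proof.
have := @cvg_harmonic R; rewrite -[X in X -> _](cvg_shiftS (@harmonic R)); exact.
Qed.

Definition mix (n : nat) t := (1 - n.+2%:R^-1) * g t + n.+2%:R^-1.

Lemma mix_gt0 n t : 0 < mix n t.
Proof.
apply: ltr_wpDl; last exact: (c_gt0 n).
by apply: mulr_ge0 => //; rewrite subr_ge0; apply: ltW; exact: (c_lt1 n).
Qed.

Lemma measurable_mix n : measurable_fun setT (mix n).
Proof. by apply: measurable_funD => //; exact: measurable_funM. Qed.

Lemma integral_mix n x : 0 <= x <= 1 ->
  (\int[mu]_(t in `[0%R, x]) (mix n t)%:E)%E = ((1 - c n) * warp g x + c n * x)%:E.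
Proof.
move=> x01; have /andP[x0 x1] := x01.
under eq_integral do rewrite EFinD.
have c1 : 0 <= 1 - c n by rewrite subr_ge0 ltW// c_lt1.
rewrite ge0_integralD//; last 2 first.
- by move=> t _; rewrite lee_fin mulr_ge0.
- apply/measurable_EFinP/measurable_funTS; exact: measurable_funM.
under eq_integral do rewrite EFinM.
rewrite ge0_integralZl_EFin//; last 2 first.
- by move=> t _; rewrite lee_fin.
- by apply/measurable_EFinP/measurable_funTS.
rewrite warpE// integral_cst// [X in (_ + _ * X)%E](_ : _ = x%:E); last first.
  rewrite [LHS]lebesgue_measure_itv/= lte_fin.
  by case: ltgtP x0 => // [_|<-]; rewrite ?sube0.
by rewrite -!EFinM -EFinD.
Qed.

Lemma mix_density n : density (mix n).
Proof.
split; [exact: measurable_mix|by move=> t; rewrite ltW// mix_gt0|].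
by rewrite integral_mix ?ler01 ?lexx// (warp1 dg) !mulr1 subrK.
Qed.

Lemma warp_mix n x : 0 <= x <= 1 ->
  warp (mix n) x = (1 - c n) * warp g x + c n * x.
Proof.
by move=> x01; apply: EFin_inj; rewrite -warpE// ?integral_mix//; exact: mix_density.
Qed.

Let cvg_mix t : mix n t @[n --> \oo] --> g t.
Proof.
have H : (1 - c n) * g t + c n @[n --> \oo] --> (1 - 0) * g t + 0.
  by apply: cvgD => //; apply: cvgM; [apply: cvgB => //; exact: cvg_cst|exact: cvg_cst].
by move: H; rewrite subr0 mul1r addr0.
Qed.

Let cvg_warp_mix t : 0 <= t <= 1 -> warp (mix n) t @[n --> \oo] --> warp g t.
Proof.
move=> t01; under eq_fun do rewrite warp_mix//.
have H : (1 - c n) * warp g t + c n * t @[n --> \oo] --> (1 - 0) * warp g t + 0 * t.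
  apply: cvgD; last by apply: cvgM => //; exact: cvg_cst.
  by apply: cvgM; [apply: cvgB => //; exact: cvg_cst|exact: cvg_cst].
by move: H; rewrite subr0 mul1r mul0r addr0.
Qed.

Lemma mix_cvg (p : R -> R) M : continuous p -> (forall t, `|p t| <= M) ->
  \int[mu]_(t in I) ((Num.sqrt (g t) * p (warp g t) -
    Num.sqrt (mix n t) * p (warp (mix n) t)) ^+ 2) @[n --> \oo] --> (0 : R).
Proof.
move=> cp pM.
have mp : measurable_fun setT p by exact: continuous_measurable_fun.
have ms h : density h -> measurable_fun I (fun t => Num.sqrt (h t) * p (warp h t)).
  move=> dh; have [mh _ _] := dh; apply: measurable_funM.
    exact: measurable_funTS (measurableT_comp measurable_sqrt mh).
  exact: measurable_funTS (measurableT_comp mp (warp_measurable dh)).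
(* From [(a - b) ^+ 2 <= 2 * a ^+ 2 + 2 * b ^+ 2] and [mix n t <= g t + 1]. *)
pose G t := M ^+ 2 * (4 * g t + 2).
apply: (@Rintegral_dominated_cvg0 _ _ _ G) => //.
- move=> n; apply: measurable_funX; apply: measurable_funB; apply: ms => //.
  exact: mix_density.
- move=> t It; have t01 : 0 <= t <= 1 by move: It; rewrite /unitI/= in_itv.
  set a := Num.sqrt (g t) * p (warp g t).
  have H : Num.sqrt (mix n t) * p (warp (mix n) t) @[n --> \oo] --> a.
    apply: cvgM.
      by apply: continuous_cvg; [exact: sqrt_continuous|exact: cvg_mix].
    by apply: continuous_cvg; [exact: cp|exact: cvg_warp_mix].
  have -> : 0 = (a - a) * (a - a) :> R by rewrite subrr mul0r.
  under eq_fun do rewrite expr2.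
  by apply: cvgM; apply: cvgB => //; exact: cvg_cst.
- have ig := density_integrable dg.
  have i1 : mu.-integrable I (EFin \o (fun t => 4 * g t)) by exact: (integrableZl mI 4 ig).
  have i2 : mu.-integrable I (EFin \o cst (2 : R)).
    apply: measurable_bounded_integrable => //; first exact: unitI_lty.
    by exists 2; split; [exact: num_real|move=> x x2 t _ /=; rewrite ger0_norm// ltW].
  exact: (integrableZl mI (M ^+ 2) (integrableD mI i1 i2)).
- move=> n t _; rewrite ger0_norm ?sqr_ge0//.
  set a := _ * _; set b := _ * _.
  have M0 : 0 <= M by rewrite (le_trans _ (pM 0)).
  have bound h s : 0 <= h -> (Num.sqrt h * p s) ^+ 2 <= h * M ^+ 2.
    move=> h0; rewrite exprMn sqr_sqrtr// ler_wpM2l//.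
    by rewrite -[leLHS]real_normK ?num_real// ler_pXn2r ?nnegrE.
  have ha := bound _ (warp g t) (g0 t).
  have hb := bound _ (warp (mix n) t) (ltW (mix_gt0 n t)).
  have hm : mix n t <= g t + 1.
    rewrite /mix -/(c n); have := c_gt0 n; have := c_lt1 n; have := g0 t; nra.
  have hb' : b ^+ 2 <= (g t + 1) * M ^+ 2.
    by rewrite (le_trans hb)// ler_wpM2r// sqr_ge0.
  have : (a - b) ^+ 2 <= 2 * a ^+ 2 + 2 * b ^+ 2.
    by have := sqr_ge0 (a + b); rewrite !expr2; lra.
  rewrite /G; move: ha hb'; rewrite -/a; lra.
Qed.

End mix.

Section split_lt.
Context {R : realType}.
Implicit Types x y a b c e : R.

Lemma lt_split2 x a b e : x <= a + b -> a < e / 2 -> b < e / 2 -> x < e.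
Proof. lra. Qed.

Lemma lt_split3 x y a b c e : x <= a + y -> y <= b + c ->
  a < e / 3 -> b < e / 3 -> c < e / 3 -> x < e.
Proof. lra. Qed.

End split_lt.

Section shape_pull.
Context {R : realType} {N : nat}.
Notation mu := (@lebesgue_measure R).
Notation I := (unitI R).
Implicit Types (q w u v : R -> 'rV[R]_N) (g h : R -> R).

(** Convergence of the warps says nothing about q composed with them unless q is continuous. So q is
    replaced by a continuous bounded p; as [pull] is isometric for both densities, this costs the
    same error on either side. *)
Lemma pull_positive_approx q g (e : R) : L2 R N q -> density g -> 0 < e ->
  exists h, [/\ density h, forall t, 0 < h t & l2dist (pull q g) (pull q h) < e].
Proof.
move=> Lq dg e0; have e3 : 0 < e / 3 by rewrite divr_gt0.
have [p [cp [M pM] qp]] := L2_continuous_rV_approx Lq e3.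
have Lp : L2 R N p by exact: L2_bounded pM.
have d0 : 0 < (e / 3) ^+ 2 / N.+1%:R by rewrite divr_gt0// exprn_gt0.
have : \forall n \near \oo, forall i : 'I_N,
   \int[mu]_(t in I) ((pull p g t 0 i - pull p (mix g n) t 0 i) ^+ 2) <
     (e / 3) ^+ 2 / N.+1%:R.
  apply: filter_forall => i.
  have /cvgr_dist_lt/(_ _ d0) := mix_cvg dg (cp i) (pM i).
  apply: filterS => n; rewrite sub0r normrN => /(le_lt_trans (ler_norm _)).
  by congr (_ < _); apply: eq_Rintegral => t _; rewrite !mxE.
move=> [n _ /(_ n (leqnn n))]/= H.
have dm := mix_density dg n.
exists (mix g n); split; [exact: dm|exact: mix_gt0|].
have h1 : l2dist (pull p g) (pull p (mix g n)) < e / 3.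
  by apply: l2dist_lt => //; exact: L2_pull.
have h2 := l2dist_pull dg Lq Lp.
have h3 := l2dist_pull dm Lp Lq.
have t1 := l2dist_triangle (L2_pull dg Lq) (L2_pull dg Lp) (L2_pull dm Lq).
have t2 := l2dist_triangle (L2_pull dg Lp) (L2_pull dm Lp) (L2_pull dm Lq).
apply: (lt_split3 t1 t2 _ h1); first by rewrite h2.
by rewrite h3 l2distC.
Qed.

(** One half of e pays for making the speed positive, the other for replacing w by an element of the
    orbit, an error that [pull] leaves unchanged. *)
Lemma shape_pull q w g : L2 R N q -> Defs.shape q w -> density g ->
  Defs.shape q (pull w g).
Proof.
move=> Lq /shapeP[Lw wq] dg; apply/shapeP; split; first exact: L2_pull.
move=> e e0; have e2 : 0 < e / 2 by rewrite divr_gt0.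
have [h [dh h0 wh]] := wq _ e2.
have [k [dk k0 wk]] := pull_positive_approx Lw dg e2.
exists (density_comp h k); split.
- exact: density_comp_density.
- by move=> t; exact: mulr_gt0.
- have E : {ae mu, forall t, I t ->
      pull q (density_comp h k) t = pull (pull q h) k t}.
    by apply: aeW => t It; rewrite pull_comp.
  rewrite (l2dist_ae _ E).
  have t1 := l2dist_triangle (L2_pull dg Lw) (L2_pull dk Lw) (L2_pull dk (L2_pull dh Lq)).
  apply: (lt_split2 t1 wk).
  by rewrite (l2dist_pull dk Lw (L2_pull dh Lq)).
Qed.

Lemma density_cst1 : density (fun=> 1 : R).
Proof.
split => //; rewrite integral_cst ?mul1e; last exact: measurable_unitI.
by rewrite [LHS]lebesgue_measure_itv/= lte01 -EFinB subr0.
Qed.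

Lemma shape_refl q : L2 R N q -> Defs.shape q q.
Proof.
move=> Lq; apply/shapeP; split=> // e e0; exists (fun=> 1); split=> //.
  exact: density_cst1.
have E : {ae mu, forall t, I t -> pull q (fun=> 1) t = q t}.
  apply: aeW => t; rewrite /unitI/= in_itv/= => t01.
  rewrite /pull sqrtr1 scale1r; congr q; apply: EFin_inj.
  rewrite -warpE//; last exact: density_cst1.
  rewrite integral_cst// mul1e [LHS]lebesgue_measure_itv/= lte_fin.
  by case/andP : t01 => + _; case: ltgtP => // [_|<-]; rewrite ?sube0.
rewrite (l2dist_ae _ E) /l2dist /l2norm /l2dot.
rewrite (_ : (\int[mu]_(t in _) _) = 0) ?sqrtr0//.
transitivity (\int[mu]_(t in I) (0 : R)).
  by apply: eq_Rintegral => t _; rewrite big1// => i _; rewrite subrr mxE mul0r.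
by rewrite Rintegral_cst ?mul0r//; exact: measurable_unitI.
Qed.

End shape_pull.

(** * Step functions and subdivisions *)

Section step_functions.
Context {R : realType} {N : nat}.
Notation I := (unitI R).

Definition bound_value (b : itv_bound R) : seq R :=
  if b is BSide _ v then [:: v] else [::].

Definition itv_endpoints (J : interval R) : seq R :=
  let: Interval l r := J in bound_value l ++ bound_value r.

Lemma mem_itv_no_endpoint (J : interval R) (u v m t : R) :
  (forall z, z \in itv_endpoints J -> ~~ (u < z < v)) ->
  u < m < v -> u < t < v -> m \in J -> t \in J.
Proof.
case: J => l r /= H /andP[um mv] /andP[ut tv].
rewrite !itv_boundlr => /andP[lm mr]; apply/andP; split.
  case: l lm H => [b z|//] lm H.
  have /H : z \in bound_value (BSide b z) ++ bound_value r by rewrite mem_cat inE eqxx.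
  have zm : z <= m by move: lm; clear H; case: b; rewrite bnd_simp => // /ltW.
  rewrite (le_lt_trans zm mv) andbT -leNgt => zu.
  have zt : z < t by rewrite (le_lt_trans zu).
  by case: b {lm H} => /=; rewrite bnd_simp ?ltW.
case: r mr H => [b z|//] mr H.
have /H : z \in bound_value l ++ bound_value (BSide b z) by rewrite mem_cat inE eqxx orbT.
have mz : m <= z by move: mr; clear H; case: b; rewrite bnd_simp => // /ltW.
rewrite (lt_le_trans um mz)/= -leNgt => vz.
have tz : t < z by rewrite (lt_le_trans tv).
by case: b {mr H} => /=; rewrite bnd_simp ?ltW.
Qed.

Lemma step_function_breakpoints (w : R -> 'rV[R]_N) : step_function w ->
  exists (n : nat) (x : nat -> R) (c : nat -> 'rV[R]_N),
    [/\ x 0%N = 0, x n = 1, forall k, (k < n)%N -> x k <= x k.+1 &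
        forall k t, (k < n)%N -> x k < t < x k.+1 -> w t = c k].
Proof.
move=> [n [J [IJ _ Jc]]].
(* The intervals come in no order and may be points. Repeated endpoints only produce empty
   pieces. *)
pose s0 := [:: 0, 1 & flatten [seq itv_endpoints (J i) | i <- enum 'I_n]].
pose s := sort <=%R [seq v <- s0 | 0 <= v <= 1].
have memS v : (v \in s) = (0 <= v <= 1) && (v \in s0).
  by rewrite mem_sort mem_filter.
have s0s : 0 \in s by rewrite memS lexx ler01 inE eqxx.
have s1s : 1 \in s by rewrite memS lexx ler01 !inE eqxx orbT.
have ss : sorted <=%R s by apply: sort_sorted; exact: le_total.
have nthS i j : (i <= j)%N -> (j < size s)%N -> nth 1 s i <= nth 1 s j.
  move=> ij js; apply: (sorted_leq_nth le_trans lexx) => //; rewrite inE//.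
  exact: leq_ltn_trans js.
have sz : (0 < size s)%N by case: (s) s0s.
have nth01 i : (i < size s)%N -> 0 <= nth 1 s i <= 1.
  by move=> /(mem_nth 1); rewrite memS => /andP[].
exists (size s).-1, (nth 1 s), (fun k => w ((nth 1 s k + nth 1 s k.+1) / 2)).
split.
- apply/eqP; rewrite eq_le; have /andP[-> _] := nth01 _ sz; rewrite andbT.
  by rewrite -[leRHS](nth_index 1 s0s) nthS// index_mem.
- have szp : ((size s).-1 < size s)%N by rewrite prednK.
  apply/eqP; rewrite eq_le; have /andP[_ ->] := nth01 _ szp => /=.
  rewrite -[leLHS](nth_index 1 s1s) nthS//.
  by rewrite -ltnS prednK// index_mem.
- by move=> k kn; apply: nthS => //; rewrite -[ltnRHS](prednK sz) ltnS.
move=> k t kn ktk.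
have k1s : (k.+1 < size s)%N by rewrite -[ltnRHS](prednK sz) ltnS.
have ks : (k < size s)%N by exact: ltn_trans k1s.
have gap z : z \in s -> ~~ (nth 1 s k < z < nth 1 s k.+1).
  move=> zs; have zi := zs; rewrite -index_mem in zi.
  rewrite -(nth_index 1 zs) negb_and -!leNgt; apply/orP.
  have [zk|kz] := leqP (index z s) k; [left|right]; exact: nthS.
(* The interval J containing the midpoint contains the whole open piece, since none of its endpoints
   lies strictly inside. *)
set m := _ / 2.
have mk : nth 1 s k < m < nth 1 s k.+1.
  by case/andP: ktk => k1 k2; apply/andP; split; rewrite /m; lra.
have mI : I m.
  rewrite /unitI/= in_itv/=; have := nth01 _ ks; have := nth01 _ k1s.
  by case/andP: mk => ? ? /andP[? ?] /andP[? ?]; apply/andP; split; lra.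
have [i _ mJ] : (\bigcup_i [set` J i]) m by rewrite -IJ.
have [c wc] := Jc i.
rewrite (wc m mJ) (wc t)//; apply: (mem_itv_no_endpoint _ mk ktk mJ) => z zJ.
have [z01|z01] := boolP (0 <= z <= 1).
  apply: gap; rewrite memS z01 !inE; apply/orP; right; apply/orP; right.
  by apply/flattenP; exists (itv_endpoints (J i)) => //; apply: map_f; rewrite mem_enum.
apply: contra z01 => /andP[kz zk]; apply/andP; split.
  by rewrite (le_trans _ (ltW kz))//; case/andP: (nth01 _ ks).
by rewrite (le_trans (ltW zk))//; case/andP: (nth01 _ k1s).
Qed.

End step_functions.

Section subdivisions.
Context {R : realType}.
Notation mu := (@lebesgue_measure R).
Notation I := (unitI R).

(** Weak inequalities make the set of subdivisions closed, at the price of degenerate pieces. Only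
    the indices up to n matter. *)
Definition subdivision (n : nat) (t : nat -> R) :=
  [/\ t 0%N = 0, t n = 1 & forall k, (k < n)%N -> t k <= t k.+1].

Lemma subdivision_le n t i j : subdivision n t -> (i <= j <= n)%N -> t i <= t j.
Proof.
move=> [_ _ tS] /andP[]; elim: j => [|j IH]; first by rewrite leqn0 => /eqP->.
rewrite leq_eqVlt => /predU1P[->//|]; rewrite ltnS => ij jn.
by rewrite (le_trans (IH ij (ltnW jn)))// tS.
Qed.

Lemma subdivision01 n t k : subdivision n t -> (k <= n)%N -> 0 <= t k <= 1.
Proof.
move=> pt kn; have [t0 t1 _] := pt; apply/andP; split.
  by rewrite -[leLHS]t0 (subdivision_le pt).
by rewrite -[leRHS]t1 (subdivision_le pt)// kn leqnn.
Qed.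

Lemma Rintegral_primitive (f : R -> R) u v : mu.-integrable I (EFin \o f) ->
  0 <= u -> u <= v -> v <= 1 ->
  \int[mu]_(t in `[u, v]) f t =
  primitive (f \_ I) v - primitive (f \_ I) u.
Proof.
move=> iF u0 uv v1; have ip := (integrable_patch_unitI f).1 iF.
rewrite primitiveB// Rintegral_itv_obnd_cbnd; last exact: integrableS ip.
apply: eq_Rintegral => t; rewrite inE => tuv; rewrite patchE mem_set//.
exact: (subset_unitI u0 v1).
Qed.

Lemma Rintegral_subdivision n t (f : R -> R) : mu.-integrable I (EFin \o f) ->
  subdivision n t ->
  \int[mu]_(s in I) f s = \sum_(k < n) \int[mu]_(s in `[t k, t k.+1]) f s.
Proof.
move=> iF pt; have [t0 t1 tS] := pt.
rewrite -[LHS]/(\int[mu]_(s in `[0, 1]) f s) Rintegral_primitive// ?ler01//.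
rewrite -[in primitive _ 1]t1 -[in primitive _ 0]t0.
rewrite -(@telescope_sumr _ 0 n (fun k => primitive (f \_ I) (t k)))//.
rewrite big_mkord; apply: eq_bigr => k _; rewrite Rintegral_primitive ?tS//.
  by have /andP[] := subdivision01 pt (ltnW (ltn_ord k)).
by have /andP[] := subdivision01 pt (ltn_ord k).
Qed.

Lemma Rintegral_itv_oo (f : R -> R) u v : mu.-integrable `[u, v] (EFin \o f) ->
  \int[mu]_(s in `[u, v]) f s = \int[mu]_(s in `]u, v[) f s.
Proof.
move=> iF; rewrite /Rintegral; congr fine; rewrite integral_itv_bndoo//.
have /integrableP[mf _] := iF.
by apply: measurable_funS mf => //; exact: subset_itv_oo_cc.
Qed.

(** A common time scale: during the k-th cell both functions traverse their k-th pieces, even when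
    one of these has length 0. *)
Definition grid (n k : nat) : R := k%:R / n%:R.

Lemma grid_subdivision n : (0 < n)%N -> subdivision n (grid n).
Proof.
move=> n0; split; first by rewrite /grid mul0r.
  by rewrite /grid divff// pnatr_eq0 -lt0n.
by move=> k _; rewrite /grid ler_pM2r ?invr_gt0 ?ltr0n// ler_nat.
Qed.

Lemma gridS n k : (0 < n)%N -> grid n k.+1 - grid n k = n%:R^-1.
Proof. by move=> n0; rewrite /grid -mulrBl -natrB// subSnn mul1r. Qed.

Lemma grid_lt n k : (0 < n)%N -> grid n k < grid n k.+1.
Proof. by move=> n0; rewrite -subr_gt0 gridS// invr_gt0 ltr0n. Qed.

Lemma piecewise_density n (f : nat -> R -> R) (y : nat -> R) : (0 < n)%N ->
  subdivision n y ->
  (forall k, (k < n)%N -> measurable_fun setT (f k)) ->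
  (forall k t, (k < n)%N -> 0 <= f k t) ->
  (forall k, (k < n)%N ->
    (\int[mu]_(t in `[grid n k, grid n k.+1]) (f k t)%:E = (y k.+1 - y k)%:E)%E) ->
  exists g, [/\ density g,
    forall k t, (k < n)%N -> grid n k < t < grid n k.+1 -> g t = f k t &
    forall k, (k <= n)%N -> warp g (grid n k) = y k].
Proof.
move=> n0 py mf f0 fy; have pg := grid_subdivision n0.
have [g0 g1 gS] := pg; have [y0 y1 _] := py.
(* Open cells are disjoint, and the grid points left out form a null set. *)
pose P k : set (measurableTypeR R) := `]grid n k, grid n k.+1[%classic.
pose g t := \sum_(k < n) f k t * \1_(P k) t.
have mg : measurable_fun setT g.
  apply: measurable_sum => k; apply: measurable_funM; first exact: mf.
  by apply: measurable_indic; exact: measurable_itv.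
have gg0 t : 0 <= g t.
  by apply: sumr_ge0 => k _; rewrite mulr_ge0 ?f0// indicE ler0n.
have gE k t : (k < n)%N -> grid n k < t < grid n k.+1 -> g t = f k t.
  move=> kn /andP[kt tk]; rewrite /g (bigD1 (Ordinal kn))//= big1 ?addr0.
    by rewrite indicE mem_set ?mulr1//= /P/= in_itv/= kt.
  move=> j jk; rewrite indicE memNset ?mulr0// /P/= in_itv/= => /andP[jt tj].
  have [lt|lt|eq] := ltngtP j k.
  - have := subdivision_le pg (_ : (j.+1 <= k <= n)%N); rewrite lt ltnW// => /(_ isT).
    by rewrite leNgt (lt_trans kt).
  - have := subdivision_le pg (_ : (k.+1 <= j <= n)%N).
    rewrite lt (ltnW (ltn_ord j)) => /(_ isT).
    by rewrite leNgt (lt_trans jt).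
  - by move: jk; rewrite -val_eqE/= eq eqxx.
have key k : (k <= n)%N -> (\int[mu]_(t in `[0%R, grid n k]) (g t)%:E = (y k)%:E)%E.
  elim: k => [_|k IH kn].
    by rewrite g0 set_itv1 integral_set1 y0.
  have gk0 : 0 <= grid n k by have /andP[] := subdivision01 pg (ltnW kn).
  have gkS := gS _ kn.
  have -> : `[0, grid n k.+1]%classic = `[0, grid n k] `|` `]grid n k, grid n k.+1].
    by rewrite -itv_bndbnd_setU// bnd_simp.
  rewrite ge0_integral_setU//=; last 3 first.
  - by apply/measurable_EFinP; exact: measurable_funTS.
  - by move=> t _; rewrite lee_fin.
  - apply/disj_setPS => t /=; rewrite !in_itv/= => -[/andP[_ tk] /andP[kt _]].
    by move: kt; rewrite ltNge tk.
  have yE : ((y k.+1)%:E = (y k)%:E + (y k.+1 - y k)%:E)%E.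
    by rewrite -EFinD subrKC.
  rewrite yE -(fy k kn) (IH (ltnW kn)); congr (_ + _)%E.
  rewrite [LHS]integral_itv_bndoo; last first.
    by apply/measurable_EFinP; apply: measurable_funTS; exact: mg.
  rewrite [RHS]integral_itv_bndoo; last first.
    by apply/measurable_EFinP; apply: measurable_funTS; exact: mf.
  by apply: eq_integral => t; rewrite inE/= in_itv/= => tk; rewrite (gE k).
have dg : density g.
  split => //; have := key n (leqnn n); rewrite g1 y1; exact.
exists g; split => // k kn; apply: EFin_inj; rewrite -key// warpE//.
exact: (subdivision01 pg).
Qed.

End subdivisions.

(** * Optimal matching *)

Section square_integrable.
Context {R : realType}.
Notation mu := (@lebesgue_measure R).
Notation I := (unitI R).

Let mI : measurable (I : set (measurableTypeR R)) := measurable_unitI.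

Definition sqint (f : R -> R) :=
  measurable_fun I f /\ mu.-integrable I (fun t => (f t ^+ 2)%:E).

Lemma sqint_le (f h : R -> R) : measurable_fun I f -> sqint h ->
  (forall t, f t ^+ 2 <= h t ^+ 2) -> sqint f.
Proof.
move=> mf [mh ih] fh; split => //; apply: (le_integrable mI _ _ ih).
  by apply/measurable_EFinP; exact: measurable_funX.
by move=> t _ /=; rewrite lee_fin !ger0_norm ?sqr_ge0.
Qed.

Lemma sqintZ k f : sqint f -> sqint (fun t => k * f t).
Proof.
move=> [mf iF]; split; first exact: measurable_funM.
have := integrableZl mI (k ^+ 2) iF; apply: eq_integrable => // t _.
by rewrite exprMn EFinM.
Qed.

Lemma sqintD f h : sqint f -> sqint h -> sqint (fun t => f t + h t).
Proof.
move=> [mf iF] [mh ih]; split; first exact: measurable_funD.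
have i3 := integrableD mI (integrableZl mI 2 iF) (integrableZl mI 2 ih).
apply: (le_integrable mI _ _ i3).
  by apply/measurable_EFinP; apply: measurable_funX; exact: measurable_funD.
move=> t _ /=; rewrite lee_fin ger0_norm ?sqr_ge0// ger0_norm; last first.
  by apply: addr_ge0; apply: mulr_ge0 => //; exact: sqr_ge0.
by have := sqr_ge0 (f t - h t); rewrite !expr2; lra.
Qed.

Lemma sqint0 : sqint (fun=> 0).
Proof.
split; first exact: measurable_cst.
by under eq_fun do rewrite expr0n; exact: integrable0.
Qed.

Lemma sqint_sum (J : Type) (s : seq J) (f : J -> R -> R) :
  (forall j, sqint (f j)) -> sqint (fun t => \sum_(j <- s) f j t).
Proof.
move=> sf; elim: s => [|j s IH].
  by under eq_fun do rewrite big_nil; exact: sqint0.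
by under eq_fun do rewrite big_cons; exact: sqintD.
Qed.

Lemma sqint_L2 N (q : R -> 'rV[R]_N) i : L2 R N q -> sqint (fun t => q t 0 i).
Proof. by move=> Lq; exact: Lq. Qed.

End square_integrable.

Section positive_part.
Context {R : realType} {N : nat}.
Implicit Types (q : R -> 'rV[R]_N) (c : 'rV[R]_N).

Definition posdot q c t : R := Num.max 0 (\sum_(i < N) q t 0 i * c 0 i).

Lemma posdot_ge0 q c t : 0 <= posdot q c t.
Proof. by rewrite /posdot le_max lexx. Qed.

Lemma sqint_posdot q c : L2 R N q -> sqint (posdot q c).
Proof.
move=> Lq.
have s : sqint (fun t => \sum_(i < N) q t 0 i * c 0 i).
  apply: sqint_sum => i; under eq_fun do rewrite mulrC.
  by apply: sqintZ; exact: sqint_L2.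
apply: (sqint_le _ s); first by apply: measurable_maxr => //; case: s.
move=> t; rewrite /posdot; have [h|h] := leP 0 (\sum_(i < N) q t 0 i * c 0 i) => //.
by rewrite expr0n sqr_ge0.
Qed.

End positive_part.

Section optimal_subdivision.
Context {R : realType}.
Notation mu := (@lebesgue_measure R).
Notation I := (unitI R).

Lemma optimal_subdivision_exists n (a : nat -> R) (f : nat -> R -> R) :
  (0 < n)%N -> (forall k, mu.-integrable I (EFin \o f k)) ->
  exists2 s, subdivision n s & forall s', subdivision n s' ->
    \sum_(k < n) a k * Num.sqrt (\int[mu]_(t in `[s' k, s' k.+1]) f k t) <=
    \sum_(k < n) a k * Num.sqrt (\int[mu]_(t in `[s k, s k.+1]) f k t).
Proof.
move=> n0 iF.
pose Phi k := primitive (f k \_ I).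
have cPhi k : continuous (Phi k).
  by apply: primitive_continuous; apply/integrable_patch_unitI.
pose ev k (v : 'rV[R]_n.+1) : R := v 0 (inord k).
have cev k : continuous (ev k) by exact: coord_continuous.
(* Integrals over moving intervals become differences of primitives. As [Num.sqrt] extends
   continuously by 0 to negative numbers, G is continuous on the whole space and not only at
   subdivisions. *)
pose G v := \sum_(k < n) a k * Num.sqrt (Phi k (ev k.+1 v) - Phi k (ev k v)).
have cG : continuous G.
  move=> v; apply: (cvg_big (op := +%R) (@add_continuous R) (@nbhs_filter _ v)) => k _.
  apply: cvgM; first exact: cvg_cst.
  apply: continuous_cvg; first exact: sqrt_continuous.
  by apply: cvgB; apply: continuous_cvg; [exact: cPhi|exact: cev|exact: cPhi|exact: cev].
have eqG s : subdivision n s ->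
    \sum_(k < n) a k * Num.sqrt (\int[mu]_(t in `[s k, s k.+1]) f k t) =
    \sum_(k < n) a k * Num.sqrt (Phi k (s k.+1) - Phi k (s k)).
  move=> ps; have [_ _ sS] := ps; apply: eq_bigr => k _.
  rewrite Rintegral_primitive ?sS//.
    by have /andP[] := subdivision01 ps (ltnW (ltn_ord k)).
  by have /andP[] := subdivision01 ps (ltn_ord k).
pose K := [set v : 'rV[R]_n.+1 | forall i, `[0, 1]%classic (v ord0 i)] `&`
  [set v | subdivision n (fun k => ev k v)].
have cK : compact K.
  apply: compact_closedI.
    apply: (@rV_compact R n.+1 (fun=> `[0, 1]%classic)) => i.
    exact: segment_compact.
  have -> : [set v | subdivision n (fun k => ev k v)] =
      ev 0%N @^-1` [set 0] `&` ev n @^-1` [set 1] `&`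
      \bigcap_(k in [set k | (k < n)%N]) (fun v => ev k v - ev k.+1 v) @^-1` `]-oo, 0].
    apply/seteqP; split => v /=.
      move=> [v0 v1 vS]; split => // k kn /=.
      by rewrite in_itv/= subr_le0 vS.
    move=> [[v0 v1] vS]; split => // k kn.
    by have := vS k kn; rewrite /= in_itv/= subr_le0.
  apply: closedI; first apply: closedI.
  - by apply: closed_comp; [move=> ? _; exact: cev|exact: closed_eq].
  - by apply: closed_comp; [move=> ? _; exact: cev|exact: closed_eq].
  - apply: closed_bigI => k _; apply: closed_comp; last exact: interval_closed.
    move=> v _; rewrite /continuous_at; apply: (@cvgB _ _ _ (nbhs v)).
      exact: cev.
    exact: cev.
have inK s : subdivision n s -> K (\row_(i < n.+1) s i).
  move=> ps; split => [i/=|/=].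
    by rewrite mxE in_itv/=; apply: (subdivision01 ps); rewrite -ltnS.
  have [s0 s1 sS] := ps.
  have evE k : (k <= n)%N -> ev k (\row_(i < n.+1) s i) = s k.
    by move=> kn; rewrite /ev mxE inordK.
  split; rewrite ?evE//.
  by move=> k kn; rewrite !evE// ?sS// ltnW.
have [v vK vmax] := compact_EVT_max (ex_intro _ _ (inK _ (grid_subdivision n0))) cK
  (continuous_subspaceT cG).
move: vK; rewrite inE => -[_ pv].
exists (fun k => ev k v) => // s' ps'; rewrite (eqG _ ps') (eqG _ pv).
have -> : \sum_(k < n) a k * Num.sqrt (Phi k (s' k.+1) - Phi k (s' k)) =
    G (\row_(i < n.+1) s' i).
  apply: eq_bigr => k _.
  by rewrite /ev !mxE !inordK ?ltnS ?(ltnW (ltn_ord k)).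
have := vmax (\row_(i < n.+1) s' i); rewrite inE; apply; exact: inK.
Qed.

End optimal_subdivision.

(** * The Cauchy-Schwarz bound *)

Section upper_bound.
Context {R : realType} {N : nat}.
Notation mu := (@lebesgue_measure R).
Notation I := (unitI R).

Let mI : measurable (I : set (measurableTypeR R)) := measurable_unitI.

Lemma measurable_sqrt_density (D : set (measurableTypeR R)) (g : R -> R) :
  density g -> measurable_fun D (fun t => Num.sqrt (g t)).
Proof.
by move=> [mg _ _]; exact: measurable_funTS (measurableT_comp measurable_sqrt mg).
Qed.

Lemma sqr_pull (g f : R -> R) t : density g ->
  (Num.sqrt (g t) * f (warp g t)) ^+ 2 = f (warp g t) ^+ 2 * g t.
Proof. by move=> [_ g0 _]; rewrite exprMn sqr_sqrtr// mulrC. Qed.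

Lemma sqint_pull (g f : R -> R) : density g -> sqint f ->
  sqint (fun t => Num.sqrt (g t) * f (warp g t)).
Proof.
move=> dg [mf iF]; have [mg g0 _] := dg.
have mp : measurable_fun I (fun t => Num.sqrt (g t) * f (warp g t)).
  apply: measurable_funM; first exact: measurable_sqrt_density.
  exact: measurable_warp_comp.
split => //; apply: ge0_integrable => //.
- exact: measurable_funX.
- by move=> t _; exact: sqr_ge0.
- under eq_integral do rewrite sqr_pull// EFinM.
  rewrite (@warp_substitution_unitI _ g (fun y => (f y ^+ 2)%:E))//.
  + exact: integrable_lty.
  + exact: measurable_int iF.
  + by move=> y _; rewrite lee_fin sqr_ge0.
Qed.

Lemma Rintegral_sqr_pull (g f : R -> R) a b : density g -> sqint f ->
  0 <= a -> a <= b -> b <= 1 ->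
  \int[mu]_(t in `[a, b]) ((Num.sqrt (g t) * f (warp g t)) ^+ 2) =
  \int[mu]_(t in `[warp g a, warp g b]) (f t ^+ 2).
Proof.
move=> dg [mf iF] a0 ab b1; rewrite /Rintegral; congr fine.
under eq_integral do rewrite sqr_pull// EFinM.
apply: (@warp_substitution _ g a b (fun y => (f y ^+ 2)%:E)) => //.
  apply/measurable_EFinP; apply: measurable_funX; apply: measurable_funS mf => //.
  apply: subset_unitI; first by rewrite -[leLHS](warp0 g) warp_nd.
  by rewrite -[leRHS](warp1 dg) warp_nd.
by move=> y _; rewrite lee_fin sqr_ge0.
Qed.

Lemma integrable_sub_unitI (f : R -> R) (D : set (measurableTypeR R)) :
  measurable D -> D `<=` I -> mu.-integrable I (EFin \o f) ->
  mu.-integrable D (EFin \o f).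
Proof. by move=> mD DI; apply: integrableS. Qed.

Variables (q w : R -> 'rV[R]_N) (n : nat) (x : nat -> R) (c : nat -> 'rV[R]_N).
Hypotheses (Lq : L2 R N q) (Lw : L2 R N w) (px : subdivision n x).
Hypothesis wc : forall k t, (k < n)%N -> x k < t < x k.+1 -> w t = c k.

(* s k is the parameter of q matched with the breakpoint x k of w. *)
Definition alignment (s : nat -> R) : R :=
  \sum_(k < n) Num.sqrt (x k.+1 - x k) *
    Num.sqrt (\int[mu]_(t in `[s k, s k.+1]) (posdot q (c k) t ^+ 2)).

(** Only h has to be positive: the times at which w passes its breakpoints must be well defined,
    while q may pause at will. *)
Lemma alignment_bound g h : density g -> density h -> (forall t, 0 < h t) ->
  exists2 s, subdivision n s & l2dot (pull q g) (pull w h) <= alignment s.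
Proof.
move=> dg dh h0; have [x0 x1 xS] := px.
have [k [dk _ hk _]] := inverse_density dh h0.
(* The time at which [warp h] passes the breakpoint [x j]. *)
pose t j := warp k (x j).
have pt : subdivision n t.
  split; first by rewrite /t x0 warp0.
    by rewrite /t x1 (warp1 dk).
  by move=> j jn; apply: (warp_nd dk); exact: xS.
have [t0 t1 tS] := pt.
exists (fun j => warp g (t j)).
  split; first by rewrite t0 warp0.
    by rewrite t1 (warp1 dg).
  by move=> j jn; apply: (warp_nd dg); exact: tS.
have LP := L2_pull dg Lq; have LW := L2_pull dh Lw.
have iF := L2_integrable_dot LP LW.
rewrite /l2dot (Rintegral_subdivision iF pt); apply: ler_sum => j _.
have jn := ltn_ord j.
have /andP[tj0 _] := subdivision01 pt (ltnW jn).
have /andP[_ tj1] := subdivision01 pt jn.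
have tjj := tS _ jn.
have sI := subset_unitI tj0 tj1.
(* The cell is open because w is known only strictly between two breakpoints. *)
pose D : set (measurableTypeR R) := `]t j, t j.+1[%classic.
have mD : measurable D by exact: measurable_itv.
have DI : D `<=` I.
  by move=> s sD; apply: sI; exact: subset_itv_oo_cc.
have wx i : (i <= n)%N -> warp h (t i) = x i.
  by move=> iN; rewrite /t hk//; exact: (subdivision01 px).
pose f s := Num.sqrt (g s) * posdot q (c j) (warp g s).
have sp := sqint_posdot (c j) Lq.
have [mf if2] := sqint_pull dg sp.
have mh := @measurable_sqrt_density D h dh.
have ih : mu.-integrable I (EFin \o h) by exact: density_integrable.
have [_ hh0 _] := dh.
have ih2 : mu.-integrable I (EFin \o (fun s => Num.sqrt (h s) ^+ 2)).
  by apply: eq_integrable ih => // s _ /=; rewrite sqr_sqrtr.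
have mfD : measurable_fun D f by exact: measurable_funS mf.
have if2D := integrable_sub_unitI mD DI if2.
have ih2D := integrable_sub_unitI mD DI ih2.
(* By substitution the two squares integrate to the two factors of the j-th term of [alignment]. *)
have CS := cauchy_schwarz_Rintegral mD mfD mh if2D ih2D.
have E1 : \int[mu]_(s in D) (f s ^+ 2) =
    \int[mu]_(s in `[warp g (t j), warp g (t j.+1)]) (posdot q (c j) s ^+ 2).
  rewrite -(Rintegral_sqr_pull dg sp tj0 tjj tj1) [RHS]Rintegral_itv_oo//.
  exact: integrable_sub_unitI if2.
have E2 : \int[mu]_(s in D) (Num.sqrt (h s) ^+ 2) = x j.+1 - x j.
  rewrite -Rintegral_itv_oo; last exact: integrable_sub_unitI ih2.
  rewrite -(wx j (ltnW jn)) -(wx j.+1 jn); apply: EFin_inj.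
  rewrite -warpB// /Rintegral fineK.
    by apply: eq_integral => s _; rewrite sqr_sqrtr.
  by apply: integrable_fin_num => //; exact: integrable_sub_unitI ih2.
rewrite mulrC -E1 -E2; apply: le_trans CS.
rewrite Rintegral_itv_oo; last exact: integrable_sub_unitI iF.
apply: le_Rintegral => //.
- exact: integrable_sub_unitI iF.
- exact: integrable_prod_sq.
move=> s; rewrite /D/= in_itv/= => /andP[ts st].
have -> : pull w h s = Num.sqrt (h s) *: c j.
  rewrite /pull (wc jn)// -(wx j (ltnW jn)) -(wx j.+1 jn).
  by rewrite !warp_lt// ?(ltW st) ?(ltW ts)//;
    [exact: le_trans (ltW ts)|exact: le_trans (ltW st) _].
have -> : \sum_(i < N) pull q g s 0 i * (Num.sqrt (h s) *: c j) 0 i =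
   Num.sqrt (g s) * (\sum_(i < N) q (warp g s) 0 i * c j 0 i) * Num.sqrt (h s).
  rewrite mulr_sumr mulr_suml; apply: eq_bigr => i _; rewrite !mxE; ring.
rewrite ler_wpM2r ?sqrtr_ge0// /f ler_wpM2l ?sqrtr_ge0//.
by rewrite /posdot le_max lexx orbT.
Qed.

End upper_bound.

(** * Equality in the bound *)

Section attainment.
Context {R : realType} {N : nat}.
Notation mu := (@lebesgue_measure R).
Notation I := (unitI R).

Let mI : measurable (I : set (measurableTypeR R)) := measurable_unitI.

(** A warp may rest for a positive time at a breakpoint of w, where the value of w is arbitrary.
    Substitution applied to the indicator of z shows that almost all of this time has speed 0, so
    that [pull] vanishes there. *)
Lemma warp_avoids_point (g : R -> R) (z : R) : density g ->
  {ae mu, forall t, I t -> g t = 0 \/ warp g t != z}.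
Proof.
move=> dg; have [mg g0 _] := dg.
have m1 : measurable_fun setT (\1_[set z] : R -> R).
  by apply: measurable_indic; exact: measurable_set1.
have m1e (D : set (measurableTypeR R)) :
    measurable_fun D (fun y => (\1_[set z] y : R)%:E).
  by apply/measurable_EFinP; exact: measurable_funTS.
have := @warp_substitution_unitI _ g (fun y => (\1_[set z] y)%:E) dg (m1e _).
have n0 y : I y -> (0%R <= (\1_[set z] y : R)%:E)%E by move=> _; rewrite lee_fin.
move=> /(_ n0); rewrite integral_indic// => int0'.
have z0 : mu ([set z] `&` I) = 0%E.
  apply/eqP; rewrite -measure_le0 -[leRHS](lebesgue_measure_set1 z).
  have mz : measurable ([set z] : set (measurableTypeR R)) by exact: measurable_set1.
  by apply: le_measure; rewrite ?inE//; exact: measurableI.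
have int0 := etrans int0' z0.
have mf : measurable_fun I (fun t => ((\1_[set z] (warp g t))%:E * (g t)%:E)%E).
  apply/measurable_EFinP; apply: measurable_funM; last exact: measurable_funTS.
  exact: measurable_funTS (measurableT_comp m1 (warp_measurable dg)).
have := (ae_eq_integral_abs mu mI mf).1.
have -> : (\int[mu]_(t in I) `|(\1_[set z] (warp g t))%:E * (g t)%:E| = 0)%E.
  rewrite -[RHS]int0; apply: eq_integral => t _.
  by rewrite gee0_abs// -EFinM lee_fin mulr_ge0.
move=> /(_ erefl); apply: aeS => t + It => /(_ It)/= [].
have [->|wz] := eqVneq (warp g t) z; last by right.
by rewrite indicE mem_set// mul1r; left.
Qed.

Variables (q w : R -> 'rV[R]_N) (n : nat) (x : nat -> R) (c : nat -> 'rV[R]_N).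
Hypotheses (Lq : L2 R N q) (Lw : L2 R N w) (px : subdivision n x).
Hypothesis wc : forall k t, (k < n)%N -> x k < t < x k.+1 -> w t = c k.

Lemma subdivision_gt0 : (0 < n)%N.
Proof.
case: n px => [[x0 x1 _]|//].
by have := oner_neq0 R; rewrite -x1 x0 eqxx.
Qed.

Let n0 := subdivision_gt0.
Let gr := @grid R n.
Let pg : subdivision n gr := grid_subdivision n0.
Let mid k := (gr k + gr k.+1) / 2.

Let gr_lt k : gr k < gr k.+1. Proof. exact: grid_lt. Qed.
Let gr_mid k : gr k < mid k. Proof. by have := gr_lt k; rewrite /mid; lra. Qed.
Let mid_gr k : mid k < gr k.+1. Proof. by have := gr_lt k; rewrite /mid; lra. Qed.

(** The inverse of the length of half a cell: constant speed [n2 * d] covers the distance d in that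
    time. *)
Let n2 : R := 2 * n%:R.
Let n2_gt0 : 0 < n2. Proof. by rewrite /n2 mulr_gt0// ltr0n n0. Qed.

Let mid_gr_dist k : n2 * (gr k.+1 - mid k) = 1.
Proof.
have -> : gr k.+1 - mid k = (gr k.+1 - gr k) / 2 by rewrite /mid; lra.
rewrite gridS ?n0// /n2 mulrACA mulrA -mulrA.
have nn : n%:R != 0 :> R by rewrite pnatr_eq0 -lt0n n0.
by field.
Qed.

Let gr_mid_dist k : n2 * (mid k - gr k) = 1.
Proof. by rewrite -(mid_gr_dist k); congr (_ * _); rewrite /mid; lra. Qed.

Let half_mass (A : set (measurableTypeR R)) (d l : R) k : measurable A -> 0 <= d ->
  A `<=` `[gr k, gr k.+1] -> mu A = l%:E -> n2 * l = 1 ->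
  (\int[mu]_(t in `[gr k, gr k.+1]) (n2 * d * \1_A t)%:E = d%:E)%E.
Proof.
move=> mA d0 sA mul nl.
under eq_integral do rewrite EFinM.
have nd : 0 <= n2 * d by rewrite mulr_ge0// ltW.
rewrite ge0_integralZl_EFin//; last first.
  by apply/measurable_EFinP; exact: measurable_indic.
rewrite integral_indic// (setIidl sA) [X in (_ * X)%E]mul -EFinM.
by congr EFin; rewrite mulrAC nl mul1r.
Qed.

Variables (s : nat -> R).
Hypothesis ps : subdivision n s.

Let ds_ge0 k : (k < n)%N -> 0 <= s k.+1 - s k.
Proof. by have [_ _ sS] := ps; move=> kn; rewrite subr_ge0 sS. Qed.

Let dx_ge0 k : (k < n)%N -> 0 <= x k.+1 - x k.
Proof. by have [_ _ xS] := px; move=> kn; rewrite subr_ge0 xS. Qed.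

Let A k : set (measurableTypeR R) := `[gr k, mid k]%classic.
Let B k : set (measurableTypeR R) := `]mid k, gr k.+1]%classic.

(* q runs from s k to s k.+1 on the first half A k of the k-th cell of the grid,
   and pauses on the second half B k. *)
Let f1 k t := n2 * (s k.+1 - s k) * \1_(A k) t.

Let density_q : exists g, [/\ density g,
    forall k t, (k < n)%N -> gr k < t < gr k.+1 -> g t = f1 k t &
    forall k, (k <= n)%N -> warp g (gr k) = s k].
Proof.
apply: piecewise_density => //.
- move=> k _; apply: measurable_funM => //.
  by apply: measurable_indic; exact: measurable_itv.
- move=> k t kn; rewrite /f1 mulr_ge0// mulr_ge0//; first exact: ltW.
  exact: ds_ge0.
- move=> k kn; apply: (half_mass (l := mid k - gr k)).
  + exact: measurable_itv.
  + exact: ds_ge0.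
  + move=> t; rewrite /A/= !in_itv/= => /andP[-> tm]/=.
    by rewrite (le_trans tm)// ltW.
  + by rewrite [LHS]lebesgue_measure_itv/= lte_fin gr_mid -EFinB.
  + exact: gr_mid_dist.
Qed.

Lemma alignment_attained : exists g h, [/\ density g, density h &
  alignment q n x c s <= l2dot (pull q g) (pull w h)].
Proof.
have [g [dg gE gs]] := density_q.
have [gr0 gr1 grS] := pg.
pose phi k t := Num.sqrt (g t) * posdot q (c k) (warp g t).
have sphi k : sqint (phi k) by apply: sqint_pull => //; exact: sqint_posdot.
(* By substitution, this is the integral of [posdot q (c k) ^+ 2] over the matched piece of q. *)
pose a k := \int[mu]_(t in `[gr k, gr k.+1]) (phi k t ^+ 2).
(* [phi k] is measurable on I only, whereas a density has to be measurable on the line. *)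
pose psq k := (fun t => phi k t ^+ 2) \_ I.
have ipsq k : mu.-integrable setT (EFin \o psq k).
  by apply/integrable_patch_unitI; have [] := sphi k.
have mpsq k : measurable_fun setT (psq k).
  by have /integrableP[/measurable_EFinP] := ipsq k.
have psq0 k t : 0 <= psq k t.
  by rewrite /psq patchE; case: ifPn => // _; exact: sqr_ge0.
have a_ge0 k : 0 <= a k by apply: Rintegral_ge0 => t _; exact: sqr_ge0.
pose dx k := x k.+1 - x k.
(* w runs through ]x k, x k.+1[ with the speed given by the equality case of
   Cauchy-Schwarz, or while q pauses if a k = 0. *)
pose f2 k t := if a k == 0 then n2 * dx k * \1_(B k) t else dx k / a k * psq k t.
have sI k : (k < n)%N -> `[gr k, gr k.+1] `<=` I.
  move=> kn; apply: subset_unitI.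
    by have /andP[] := subdivision01 pg (ltnW kn).
  by have /andP[] := subdivision01 pg kn.
have ipk k : (k < n)%N -> mu.-integrable `[gr k, gr k.+1] (EFin \o (fun t => phi k t ^+ 2)).
  by move=> kn; apply: integrable_sub_unitI => //; [exact: sI|have [] := sphi k].
have [h [dh hE hx]] : exists h, [/\ density h,
    forall k t, (k < n)%N -> gr k < t < gr k.+1 -> h t = f2 k t &
    forall k, (k <= n)%N -> warp h (gr k) = x k].
  apply: piecewise_density => //.
  - move=> k _; rewrite /f2; case: (a k == 0); apply: measurable_funM => //.
    by apply: measurable_indic; exact: measurable_itv.
  - move=> k t kn; rewrite /f2; case: ifPn => _.
      rewrite mulr_ge0// mulr_ge0//; first exact: ltW.
      exact: dx_ge0.
    apply: mulr_ge0; last exact: psq0.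
    by apply: divr_ge0; [exact: dx_ge0|exact: a_ge0].
  - move=> k kn; rewrite /f2; case: (eqVneq (a k) 0) => [_|ak].
      apply: (half_mass (l := gr k.+1 - mid k)).
      + exact: measurable_itv.
      + exact: dx_ge0.
      + move=> t; rewrite /B/= !in_itv/= => /andP[mt ->]; rewrite andbT.
        by rewrite (le_trans _ (ltW mt))// ltW.
      + by rewrite [LHS]lebesgue_measure_itv/= lte_fin mid_gr -EFinB.
      + exact: mid_gr_dist.
    under eq_integral do rewrite EFinM.
    rewrite ge0_integralZl_EFin//; last 3 first.
    + by move=> t _; rewrite lee_fin.
    + by apply/measurable_EFinP; apply: measurable_funTS; exact: mpsq.
    + by apply: divr_ge0; [exact: dx_ge0|exact: a_ge0].
    rewrite (_ : (\int[mu]_(t in _) _)%E = (a k)%:E).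
      by rewrite -EFinM divfK.
    rewrite /a /Rintegral fineK; last by apply: integrable_fin_num => //; exact: ipk.
    by apply: eq_integral => t /[!inE] tk; rewrite /psq patchE mem_set//; exact: sI tk.
exists g, h; split => //.
have iF := L2_integrable_dot (L2_pull dg Lq) (L2_pull dh Lw).
rewrite /l2dot (Rintegral_subdivision iF pg); apply: ler_sum => k _.
have kn := ltn_ord k.
have /andP[k0 _] := subdivision01 pg (ltnW kn).
have /andP[_ k1] := subdivision01 pg kn.
have -> : \int[mu]_(t in `[s k, s k.+1]) (posdot q (c k) t ^+ 2) = a k.
  rewrite /a -(gs k (ltnW kn)) -(gs k.+1 kn).
  rewrite -(Rintegral_sqr_pull dg (sqint_posdot (c k) Lq) k0 _ k1)//.
  exact: grS.
rewrite -/(dx k).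
pose D : set (measurableTypeR R) := `]gr k, gr k.+1[%classic.
have mD : measurable D by exact: measurable_itv.
have DI : D `<=` I by move=> t tD; apply: (sI k kn); exact: subset_itv_oo_cc.
have iFD := integrable_sub_unitI mD DI iF.
rewrite Rintegral_itv_oo; last exact: integrable_sub_unitI (sI k kn) iF.
(* The ratio of [Num.sqrt (h t)] to [phi k t] when [a k] is nonzero. If [a k = 0], the convention
   for inverses gives r = 0, which is the value needed then. *)
pose r := Num.sqrt (dx k / a k).
have r0 : a k = 0 -> r = 0 by move=> ak; rewrite /r ak invr0 mulr0 sqrtr0.
have phi0 t : 0 <= phi k t by rewrite mulr_ge0 ?sqrtr_ge0// posdot_ge0.
have pointwise t : gr k < t < gr k.+1 -> h t = 0 \/ warp h t != x k ->
    h t = 0 \/ warp h t != x k.+1 ->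
    \sum_(i < N) pull q g t 0 i * pull w h t 0 i = r * phi k t ^+ 2.
  move=> tk Hx Hx'; have ht := hE _ _ kn tk; have gt := gE _ _ kn tk.
  have It : I t by apply: DI; rewrite /D/= in_itv.
  have [ht0|hn0] := eqVneq (h t) 0.
    rewrite big1 => [|i _]; last by rewrite !mxE ht0 sqrtr0 mul0r mulr0.
    have [ak|ak] := eqVneq (a k) 0; first by rewrite r0// mul0r.
    move: ht; rewrite ht0 /f2 (negbTE ak) /psq patchE mem_set// => /esym/eqP.
    rewrite mulf_eq0 => /orP[/eqP E|/eqP ->]; last by rewrite mulr0.
    by rewrite /r E sqrtr0 mul0r.
  have wk : x k < warp h t < x k.+1.
    case: Hx => [|xk]; first by move/eqP; rewrite (negbTE hn0).
    case: Hx' => [|xk']; first by move/eqP; rewrite (negbTE hn0).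
    have /andP[t1 t2] := tk.
    rewrite !lt_neqAle eq_sym xk xk' /= -(hx k (ltnW kn)) -(hx k.+1 kn).
    by rewrite !(warp_nd dh) ?(ltW t1) ?(ltW t2).
  set S := \sum_(i < N) q (warp g t) 0 i * c k 0 i.
  have -> : \sum_(i < N) pull q g t 0 i * pull w h t 0 i =
      Num.sqrt (g t) * S * Num.sqrt (h t).
    rewrite mulr_sumr mulr_suml; apply: eq_bigr => i _.
    by rewrite !mxE (wc kn wk); ring.
  (* If [a k = 0], then h vanishes on the first half of the cell and g on the second, so the product
     is 0 throughout. *)
  have [ak|ak] := eqVneq (a k) 0.
    rewrite r0// mul0r; have [tm|mt] := leP t (mid k).
      move: hn0; rewrite ht /f2 ak eqxx indicE memNset ?mulr0 ?eqxx//.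
      by rewrite /B/= in_itv/= => /andP[]; rewrite ltNge tm.
    rewrite gt /f1 indicE memNset ?mulr0 ?sqrtr0 ?mul0r//.
    by rewrite /A/= in_itv/= => /andP[_]; rewrite leNgt mt.
  have -> : Num.sqrt (h t) = r * phi k t.
    rewrite ht /f2 (negbTE ak) /psq patchE mem_set// sqrtrM; last first.
      by apply: divr_ge0; [exact: dx_ge0|exact: a_ge0].
    by rewrite sqrtr_sqr ger0_norm.
  (* Where S < 0 the speed of w is 0: the negative part of the scalar product is never collected, so
     passing to the positive part in the bound loses nothing. *)
  rewrite /phi /posdot -/S; have [S0|S0] := leP 0 S; first ring.
  by rewrite !mulr0 expr0n mulr0.
have E : \int[mu]_(t in D) (\sum_(i < N) pull q g t 0 i * pull w h t 0 i) =
    \int[mu]_(t in D) (r * phi k t ^+ 2).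
  rewrite /Rintegral; congr fine; apply: ae_eq_integral => //.
  - by have /integrableP[] := iFD.
  - apply/measurable_EFinP; apply: measurable_funM => //; apply: measurable_funX.
    by apply: measurable_funS (sphi k).1.
  apply: aeS2 (warp_avoids_point (x k) dh) (warp_avoids_point (x k.+1) dh).
  move=> t Hx Hx' tD; have It := DI _ tD; congr EFin.
  by apply: pointwise (Hx It) (Hx' It); move: tD; rewrite /D/= in_itv.
have ipD := integrable_sub_unitI mD DI (sphi k).2.
rewrite E RintegralZl// -Rintegral_itv_oo; last exact: ipk.
rewrite -/(a k); have [ak|ak] := eqVneq (a k) 0.
  by rewrite ak sqrtr0 !mulr0.
rewrite /r sqrtrM ?dx_ge0// sqrtrV ?a_ge0//.
rewrite -mulrA -{3}(sqr_sqrtr (a_ge0 k)) expr2 mulKf// sqrtr_eq0 -ltNge.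
by rewrite lt_neqAle eq_sym ak a_ge0.
Qed.

End attainment.

(** * From orbits to closed orbits *)

Section matching.
Context {R : realType} {N : nat}.
Notation mu := (@lebesgue_measure R).
Notation I := (unitI R).
Implicit Types (q w u v : R -> 'rV[R]_N).

(** Every member of a class generates it. As [pull] is isometric, inverting g turns the closeness of
    w to [pull q g] into closeness of [pull w k] to q. *)
Lemma shape_trans q w v : L2 R N q -> Defs.shape q w -> Defs.shape q v ->
  Defs.shape w v.
Proof.
move=> Lq /shapeP[Lw qw] /shapeP[Lv qv]; apply/shapeP; split=> // e e0.
have e2 : 0 < e / 2 by rewrite divr_gt0.
have [g [dg g0 wg]] := qw _ e2.
have [h [dh h0 vh]] := qv _ e2.
have [k [dk k0 gk gk1]] := inverse_density dg g0.
exists (density_comp k h); split.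
- exact: density_comp_density.
- by move=> t; exact: mulr_gt0.
have E1 : {ae mu, forall t, I t -> pull w (density_comp k h) t = pull (pull w k) h t}.
  by apply: aeW => t It; rewrite pull_comp.
have E2 : {ae mu, forall t, I t -> pull (pull q g) k t = q t}.
  apply: aeW => t; rewrite /unitI/= in_itv/= => t01.
  have [_ g0' _] := dg.
  by rewrite /pull scalerA mulrC -sqrtrM// gk1// sqrtr1 scale1r gk.
have Lwk := L2_pull dk Lw; have Lqg := L2_pull dg Lq.
rewrite (l2dist_ae _ E1).
apply: (lt_split2 (l2dist_triangle Lv (L2_pull dh Lq) (L2_pull dh Lwk)) vh).
rewrite (l2dist_pull dh Lq Lwk) l2distC -(l2dist_ae _ E2).
by rewrite (l2dist_pull dk Lw Lqg).
Qed.

(** A stands for the sum of the squared norms, constant along orbits, and M, M' for inner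
    products. *)
Lemma ler_sqr_dist (a b A M M' : R) : 0 <= a -> 0 <= b ->
  a ^+ 2 = A - 2 * M -> b ^+ 2 = A - 2 * M' -> M' <= M -> a <= b.
Proof.
move=> a0 b0 aE bE MM; rewrite -(@ler_pXn2r _ 2)// ?nnegrE//.
by rewrite aE bE; lra.
Qed.

Lemma le_split3 (x y y' z a c e : R) : x <= y -> y <= a + y' -> y' <= z + c ->
  a < e / 2 -> c < e / 2 -> x <= z + e.
Proof. lra. Qed.

(** The bound concerns orbits; arbitrary competitors in the closures are approached by orbit
    elements up to an e that is then let go to 0. *)
Lemma matching_exists q q' w : L2 R N q -> L2 R N q' -> Defs.shape q' w ->
  step_function w -> exists u v, [/\ Defs.shape q u, Defs.shape q' v &
    forall u' v', Defs.shape q u' -> Defs.shape q' v' ->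
      l2dist u v <= l2dist u' v'].
Proof.
move=> Lq Lq' Ww /step_function_breakpoints[n [x [c [x0 x1 xS wc]]]].
have Lw : L2 R N w by case: Ww.
have px : subdivision n x by [].
have n0 := subdivision_gt0 px.
have iF k : mu.-integrable I (EFin \o (fun t => posdot q (c k) t ^+ 2)).
  exact: (sqint_posdot (c k) Lq).2.
have [s ps smax] := optimal_subdivision_exists
  (fun k => Num.sqrt (x k.+1 - x k)) n0 iF.
have [g [h [dg dh al]]] := alignment_attained Lq Lw px wc ps.
exists (pull q g), (pull w h); split.
- by apply: shape_pull => //; exact: shape_refl.
- exact: shape_pull.
(* The competitor v is now approximated by reparametrizations of the step function w instead of
   [q']. *)
move=> u v Qu /(shape_trans Lq' Ww)/shapeP[Lv wv].
have /shapeP[Lu qu] := Qu.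
apply/ler_addgt0Pr => e e0.
have e2 : 0 < e / 2 by rewrite divr_gt0.
have [g1 [dg1 _ ug]] := qu _ e2.
have [h1 [dh1 h10 vh]] := wv _ e2.
have [s1 ps1 al1] := alignment_bound Lq Lw px wc dg1 dh1 h10.
have Lqg := L2_pull dg Lq; have Lwh := L2_pull dh Lw.
have Lqg1 := L2_pull dg1 Lq; have Lwh1 := L2_pull dh1 Lw.
have le1 : l2dist (pull q g) (pull w h) <= l2dist (pull q g1) (pull w h1).
  have := l2dist_sqr Lqg Lwh; rewrite (l2dot_pull dg Lq) (l2dot_pull dh Lw) => E1.
  have := l2dist_sqr Lqg1 Lwh1; rewrite (l2dot_pull dg1 Lq) (l2dot_pull dh1 Lw) => E2.
  apply: (ler_sqr_dist (l2dist_ge0 _ _) (l2dist_ge0 _ _) E1 E2).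
  exact: le_trans al1 (le_trans (smax _ ps1) al).
apply: (le_split3 le1 (l2dist_triangle Lqg1 Lu Lwh1) (l2dist_triangle Lu Lv Lwh1) _ vh).
by rewrite l2distC.
Qed.

End matching.

Theorem theorem4 (R : realType) (N : nat) (Q W : set (R -> 'rV[R]_N)) :
  shape_space R N Q -> step_shape_space R N W ->
  exists qt wt : R -> 'rV[R]_N,
    Q qt /\ W wt /\ l2dist qt wt = shape_dist Q W.
Proof.
move=> [q Lq <-] [[q' Lq' <-] [w Ww step_w]].
have [u [v [Qu Wv uv_min]]] := matching_exists Lq Lq' Ww step_w.
exists u, v; split; [exact: Qu|split; [exact: Wv|]].
rewrite /shape_dist; set S := image _ _.
have Suv : S (l2dist u v) by exists (u, v).
have lbS : lbound S (l2dist u v) by move=> _ [[u' v'] [Qu' Wv'] <-]; exact: uv_min.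
apply/eqP; rewrite eq_le; apply/andP; split.
  by apply: lb_le_inf => //; exists (l2dist u v).
by apply: ge_inf => //; exists (l2dist u v).
Qed.
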